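(* Let $R$ be a finite (commutative) local ring, let $k\ge 1$, and let $\xi_1,\dots,\xi_k$ be probability distributions on $R$ such that, for each $i$, the support of $\xi_i$ (a) contains two elements that differ by a unit of $R$, and (b) is not contained in an affine translate of a proper subring of $R$. For each $N\ge 1$, let $\mathcal{M}_1,\dots,\mathcal{M}_k$ be independent random $N\times N$ matrices over $R$, where the entries of $\mathcal{M}_i$ are independent and each have distribution $\xi_i$, and let $\mathcal{U}_1,\dots,\mathcal{U}_k$ be independent, uniformly random $N\times N$ matrices over $R$. Then $$\mathrm{coker}(\mathcal{M}_1\mathcal{M}_2\cdots\mathcal{M}_k)\;\sim\;\mathrm{coker}(\mathcal{U}_1\mathcal{U}_2\cdots\mathcal{U}_k),$$ that is, there exist constants $c>0$ and $K>0$, not depending on $N$, such that for all $N\ge 1$ $$d_{TV}\big(\mathrm{coker}(\mathcal{M}_1\mathcal{M}_2\cdots\mathcal{M}_k),\ \mathrm{coker}(\mathcal{U}_1\mathcal{U}_2\cdots\mathcal{U}_k)\big)\le K e^{-cN}.$$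
   Context: $d_{TV}(X,Y)$ denotes the total variation distance between the distributions of the random variables $X$ and $Y$. For an $N\times N$ matrix $A$ over $R$, $\mathrm{coker}(A)=R^N/A R^N$, the quotient of $R^N$ by the column span of $A$, regarded as a random isomorphism class of $R$-modules when $A$ is random. An affine translate of a subring $S\subset R$ is a set of the form $\{us+b : s\in S\}$ with $u,b\in R$; subrings contain $1$. *)

(* Defs.v *)
From HB Require Import structures.
From mathcomp Require Import all_boot all_order all_algebra.
From mathcomp Require Import all_classical all_reals all_analysis.

Set Implicit Arguments.
Unset Strict Implicit.
Unset Printing Implicit Defensive.

Import Order.TTheory GRing.Theory Num.Theory.

Local Open Scope classical_set_scope.
Local Open Scope ring_scope.
Local Open Scope quotient_scope.

(* [idealr_closed] excludes the unit ideal. *)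
Definition maximal_ideal (R : finComUnitRingType) (m : {set R}) : Prop :=
  idealr_closed m /\
  forall J : {set R}, idealr_closed J -> m \subset J -> J = m.

Definition local_ring (R : finComUnitRingType) : Prop :=
  exists! m : {set R}, maximal_ideal m.

Definition proper_subring (R : finComUnitRingType) (S : {set R}) : Prop :=
  subring_closed S /\ S != [set: R]%SET.

Definition affine_translate (R : finComUnitRingType) (u b : R) (S : {set R}) :
    {set R} := [set u * s + b | s in S]%SET.

Section Cokernel.
Variables (R : finComUnitRingType) (N : nat) (A : 'M[R]_N).

Definition colspan : {pred 'cV[R]_N} :=
  [pred v | [exists w : 'cV[R]_N, v == A *m w]].

Lemma colspan_submod_closed : submod_closed colspan.
Proof.
split; first by apply/existsP; exists 0; rewrite mulmx0.
move=> a u v /existsP[x /eqP->] /existsP[y /eqP->].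
by apply/existsP; exists (a *: x + y); rewrite mulmxDr scalemxAr.
Qed.

HB.instance Definition _ :=
  GRing.isSubmodClosed.Build R 'cV[R]_N colspan
    (GRing.submod_closed_semi colspan_submod_closed).

(* The library quotient of a zmodType by an additive subgroup, to which the
   scalar multiplication is added below. *)
Definition coker : Type := Quotient.quot colspan.

HB.instance Definition _ := GRing.Zmodule.on coker.

Local Notation pi := (\pi_(Quotient.quot colspan) : 'cV[R]_N -> coker).

Definition coker_scale (a : R) (x : coker) : coker := pi (a *: repr x).

Lemma coker_piZ (a : R) (v : 'cV[R]_N) : coker_scale a (pi v) = pi (a *: v).
Proof.
apply/eqmodP; rewrite /= Quotient.equivE -scalerBr rpredZ //.
by rewrite Quotient.idealrBE reprK.
Qed.

Lemma coker_piD (v w : 'cV[R]_N) : pi v + pi w = pi (v + w).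
Proof. exact/esym/(raddfD (\pi_(Quotient.quot colspan))). Qed.

Lemma coker_reprK (x : coker) : pi (repr x) = x.
Proof. exact: reprK. Qed.

Lemma coker_scalerA (a b : R) (x : coker) :
  coker_scale a (coker_scale b x) = coker_scale (a * b) x.
Proof. by rewrite -[x]coker_reprK !coker_piZ scalerA. Qed.

Lemma coker_scale1r : left_id 1 coker_scale.
Proof. by move=> x; rewrite -[x in LHS]coker_reprK coker_piZ scale1r coker_reprK. Qed.

Lemma coker_scalerDr : right_distributive coker_scale +%R.
Proof.
move=> a x y; rewrite -[x]coker_reprK -[y]coker_reprK.
by rewrite coker_piD !coker_piZ coker_piD scalerDr.
Qed.

Lemma coker_scalerDl (x : coker) : {morph coker_scale^~ x : a b / a + b}.
Proof.
by move=> a b; rewrite -[x]coker_reprK !coker_piZ coker_piD scalerDl.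
Qed.

HB.instance Definition _ := GRing.Zmodule_isLmodule.Build R coker
  coker_scalerA coker_scale1r coker_scalerDr coker_scalerDl.

End Cokernel.

Definition isomorphic (R : pzRingType) (V W : lmodType R) : Prop :=
  exists f : {linear V -> W}, bijective f.

(* The isomorphism class of [V]; classes are equal iff the modules are
   isomorphic. The type [set (lmodType R)] is ruled out by universe
   constraints, hence the bare predicate. *)
Definition iso_class (R : pzRingType) (V : lmodType R) : lmodType R -> Prop :=
  isomorphic V.

Lemma isomorphic_sym (R : pzRingType) (V W : lmodType R) :
  isomorphic V W -> isomorphic W V.
Proof.
move=> [f [g fK gK]].
have glin : linear g.
  by move=> a x y; rewrite -{1}[x]gK -{1}[y]gK -linearP fK.
pose g' : {linear W -> V} := HB.pack g (GRing.isLinear.Build _ _ _ _ g glin).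
by exists g'; exists f.
Qed.

Lemma isomorphic_trans (R : pzRingType) (U V W : lmodType R) :
  isomorphic U V -> isomorphic V W -> isomorphic U W.
Proof. by move=> [f bf] [g bg]; exists (g \o f); apply: bij_comp. Qed.

Lemma iso_classP (R : pzRingType) (V W : lmodType R) :
  iso_class V = iso_class W <-> isomorphic V W.
Proof.
split=> [VW|VW].
  have WW : iso_class W W by exists idfun; exists idfun.
  by move: WW; rewrite -VW.
apply: functional_extensionality_dep => U.
apply: propositional_extensionality; split; apply: isomorphic_trans => //.
exact: isomorphic_sym.
Qed.

Section FiniteProbability.
Variable F : realType.

Definition is_distribution (T : finType) (p : T -> F) : Prop :=
  (forall x, 0 <= p x) /\ \sum_x p x = 1.

Definition support_of (T : finType) (p : T -> F) : {set T} :=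
  [set x | p x != 0]%SET.

Definition uniform_distribution (T : finType) : T -> F :=
  fun=> #|T|%:R^-1.

(* Law of a family of independent variables, the i-th one having law [p i]. *)
Definition independent_law (k : nat) (T : finType) (p : 'I_k -> T -> F) :
    {ffun 'I_k -> T} -> F :=
  fun X => \prod_(i < k) p i (X i).

(* Law of a matrix with independent entries of law [xi]. *)
Definition iid_matrix_law (T : finType) (N : nat) (xi : T -> F) :
    'M[T]_N -> F :=
  fun A => \prod_(i < N) \prod_(j < N) xi (A i j).

Definition prob (Omega : finType) (P : Omega -> F) (E : set Omega) : F :=
  \sum_(w in E) P w.

(* [X] and [Y] live on finite probability spaces [(Omega, P)] and
   [(Omega', P')]; the supremum is over all events [E] in the common range. *)
Definition dTV (Omega Omega' : finType) (T : Type)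
    (P : Omega -> F) (X : Omega -> T) (P' : Omega' -> F) (Y : Omega' -> T) : F :=
  sup [set r | exists E : T -> Prop,
    r = `|prob P [set w | E (X w)] - prob P' [set w | E (Y w)]|].

End FiniteProbability.

Definition coker_prod (R : finComUnitRingType) (k N : nat)
    (M : {ffun 'I_k -> 'M[R]_N}) : lmodType R -> Prop :=
  iso_class (coker (\prod_(i < k) M i)).

(* Main.v *)
Require Import Defs.
From HB Require Import structures.
From mathcomp Require Import all_boot all_order all_fingroup all_algebra.
From mathcomp Require Import ring lra zify.
From mathcomp Require Import all_classical all_reals all_analysis.

(* The factors are replaced by uniform ones one at a time, from the last to the
   first. Let [A] be the product of the factors that precede [X]. The class of
   [coker (A X)] is unchanged when [X] is multiplied on the right by a unit, and
   on the left by a unit [U] such that [A U = V A] for some unit [V]. Write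
   [X = [M | Y]] with [M] of width [L], where [N - L] is a small fraction of [N].
   Adding [M K] to [Y] for a uniform [K] replaces each column [y] of [Y] by
   [y + M k], whose law is close to uniform in the chi-square sense. Once [Y] is
   uniform, all the [M] such that [P A M] is left invertible are equivalent under
   row operations, [P A] being a right invertible piece of [A]; so the mean
   depends neither on [M] nor on the law of the entries.

   The error in both steps is governed by the sum of [rho(w) ^ N] over the
   vectors [w] of [R^L] with a unit entry, where [rho(w)] is the largest atom of
   [\sum_j w_j x_j]. Let [H] be the additive group spanned by the elements that
   occur often in [w]. A coupling argument shows that [rho(w)] is about [1 / |R|]
   if [H = R], and at most about [theta / |H|] with [theta < 1] otherwise: unless
   the elements [h x], with [h] in [H] and [x] in the support, span a larger
   group, [H] is an ideal and a unit entry of [w] leaves its cosets. There are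
   about [|H| ^ L] vectors of the second kind, so they contribute
   [theta ^ L]. *)

Set Implicit Arguments.
Unset Strict Implicit.
Unset Printing Implicit Defensive.

Import Order.TTheory GRing.Theory Num.Theory.

Local Open Scope ring_scope.

(** * Local rings *)

(** A nonunit [x] generates a proper ideal. Among the finitely many proper ideals containing [x],
    one of largest cardinality is maximal, hence equal to [m]. A unit sum of two nonunits would then
    put 1 in [m]. The rest of the proof uses locality only through this closure property. *)
Lemma local_ring_nonunitD (R : finComUnitRingType) : local_ring R ->
  forall x y : R, x \isn't a GRing.unit -> y \isn't a GRing.unit ->
  x + y \isn't a GRing.unit.
Proof.
case=> m [[m_id m_max] m_uniq].
have nonunit_m (x : R) : x \isn't a GRing.unit -> x \in m.
  move=> xNU; pose I0 := [set a * x | a in [set: R]].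
  have I0_id : idealr_closed I0.
    split; first by apply/imsetP; exists 0; rewrite ?inE ?mul0r.
      apply/negP => /imsetP[a _ /esym ax1].
      by move: xNU; rewrite (_ : x \is a GRing.unit) //; apply/unitrPr; exists a;
         rewrite mulrC.
    move=> a u v /imsetP[b _ ->] /imsetP[c _ ->].
    by apply/imsetP; exists (a * b + c); rewrite ?inE // mulrDl mulrA.
  have I0x : x \in I0 by apply/imsetP; exists 1; rewrite ?inE ?mul1r.
  have P0 : [pred J : {set R} | `[< idealr_closed J >] && (x \in J)] I0.
    by rewrite /= I0x andbT; apply/asboolP.
  case: (@arg_maxnP _ I0 _ (fun J : {set R} => #|J|) P0) => J /= /andP[].
  move=> /asboolP J_id xJ Jmax.
  suff -> : m = J by [].
  apply: m_uniq; split=> // J' J'_id JJ'.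
  apply/esym/eqP; rewrite eqEcard JJ' Jmax //=.
  by rewrite (fintype.subsetP JJ') // andbT; apply/asboolP.
case: m_id => m0 m1 mid x y /nonunit_m xm /nonunit_m ym.
apply/negP => xyU; move: m1.
rewrite -(mulVr xyU) -[_ * _]addr0 mid //.
by rewrite -[x]mul1r mid.
Qed.

Section LocalElimination.
Variable R : finComUnitRingType.
Hypothesis nonunitD : forall x y : R, x \isn't a GRing.unit ->
  y \isn't a GRing.unit -> x + y \isn't a GRing.unit.

Lemma nonunitM (x y : R) : y \isn't a GRing.unit -> x * y \isn't a GRing.unit.
Proof. by apply: contraNN; rewrite unitrM => /andP[]. Qed.

Lemma nonunit_mulmx m n (B : 'M[R]_(m, n)) (v : 'cV[R]_n) :
  (forall i, v i 0 \isn't a GRing.unit) ->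
  forall i, (B *m v) i 0 \isn't a GRing.unit.
Proof.
move=> vNU i; rewrite mxE; elim/big_ind: _ => [|x y|j _] //.
- by rewrite unitr0.
- exact: nonunitD.
- exact: nonunitM.
Qed.

(** Gaussian elimination modulo the maximal ideal, by induction on the columns. A unit in the first
    column serves as pivot and the Schur complement [B'] has one column less; if there is none, the
    first basis vector is the required [w]. *)
Lemma local_elimination (L s : nat) (A : 'M[R]_(L + s, L)) :
  (exists2 G : 'M[R]_(L + s), G \in unitmx & G *m A = col_mx 1%:M 0) \/
  (exists w : 'cV[R]_L, (exists i, w i 0 \is a GRing.unit) /\
     forall i, (A *m w) i 0 \isn't a GRing.unit).
Proof.
elim: L A => [|L IH] A.
  left; exists 1%:M; first exact: unitmx1.
  by apply/matrixP => i [].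
have [/existsP[i0 Ai0]|/existsPn AN] :=
  boolP [exists i, A i 0 \is a GRing.unit]; last first.
  right; exists (delta_mx 0 0); split; first by exists 0; rewrite mxE !eqxx unitr1.
  by move=> i; rewrite -colE mxE.
pose A1 : 'M[R]_(1 + (L + s), 1 + L) := xrow 0 i0 A.
pose a := ulsubmx A1; pose r := ursubmx A1; pose c := dlsubmx A1.
pose B := drsubmx A1; pose u := a 0 0.
have uU : u \is a GRing.unit.
  rewrite /u /a /A1 !mxE.
  have -> : lshift (L + s) (0 : 'I_1) = 0 :> 'I_(1 + (L + s)) by apply/val_inj.
  have -> : lshift L (0 : 'I_1) = 0 :> 'I_(1 + L) by apply/val_inj.
  by rewrite tpermL.
have aE : a = u%:M by rewrite [a]mx11_scalar.
have A1E : A1 = block_mx u%:M r c B by rewrite -aE submxK.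
pose G1 : 'M[R]_(1 + (L + s)) := block_mx (u^-1)%:M 0 (- u^-1 *: c) 1%:M.
have G1U : G1 \in unitmx.
  by rewrite unitmxE det_lblock det1 mulr1 det_scalar expr1 unitrV.
have G1A : G1 *m A1 = block_mx 1%:M (u^-1 *: r) 0 (B - u^-1 *: (c *m r)).
  rewrite A1E mulmx_block.
  rewrite !mul0mx !addr0.
  rewrite !(@mul1mx R (L+s)).
  rewrite !mul_scalar_mx scale_scalar_mx mulVr // mul_mx_scalar scalerA mulrN divrr //.
  by rewrite scaleN1r addNr -scalemxAl scaleNr addrC.
pose r' := u^-1 *: r; pose B' : 'M[R]_(L + s, L) := B - u^-1 *: (c *m r).
pose X : 'M[R]_(1 + (L + s)) := tperm_mx 0 i0.
have A1X : A1 = X *m A by rewrite /A1 xrowE.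
have XU : X \in unitmx by apply: unitmx_perm.
have GXU : G1 *m X \in unitmx by rewrite unitmx_mul G1U.
case: (IH B') => [[G GU GB]|[w [[i wi] wN]]].
  (* [G2] reduces the Schur complement, and [G3] then clears the rest [r'] of the pivot row with the
     identity block below it. *)
  left; pose G2 : 'M[R]_(1 + (L + s)) := block_mx 1%:M 0 0 G.
  pose G3 : 'M[R]_(1 + (L + s)) := block_mx 1%:M (- row_mx r' 0) 0 1%:M.
  have G3U : G3 \in unitmx by rewrite unitmxE det_ublock !det1 mulr1 unitr1.
  have G2U : G2 \in unitmx by rewrite unitmxE det_ublock det1 mul1r -unitmxE.
  exists (G3 *m (G2 *m (G1 *m X))).
    by rewrite unitmx_mul G3U unitmx_mul G2U.
  have -> : G3 *m (G2 *m (G1 *m X)) *m A = G3 *m (G2 *m (G1 *m A1)).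
    by rewrite A1X !mulmxA.
  rewrite G1A /G2 mulmx_block !mul1mx !mul0mx !mulmx0 !addr0 !add0r.
  rewrite -/r' -/B' GB /G3 mulmx_block !mul1mx !mul0mx !mulmx0 !addr0 !add0r.
  rewrite mulNmx mul_row_col mulmx1 mul0mx addr0 subrr.
  rewrite (scalar_mx_block 1 L (1 : R)).
  rewrite !block_mxEv -[X in row_mx X (col_mx _ _)]col_mx0 -block_mxEh block_mxEv row_mx0.
  by rewrite (col_mxA (m1 := 1)) castmx_id.
(* The added top entry makes the pivot row vanish on the vector, which leaves [B' w]; undoing the
   invertible row operations keeps all entries nonunits. *)
right; exists (col_mx (- (r' *m w)) w); split.
  by exists (rshift 1 i); rewrite (@col_mxEd _ 1 L 1).
suff E : A *m (col_mx (- (r' *m w)) w : 'cV_(1 + L)) =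
   invmx (G1 *m X) *m (col_mx 0 (B' *m w) : 'cV_(1 + (L + s))).
  move=> j; rewrite E; apply: (nonunit_mulmx (n := 1 + (L + s))) => {}j.
  rewrite mxE; case: (fintype.split j) => k; first by rewrite mxE unitr0.
  exact: wN.
have H : G1 *m A1 *m (col_mx (- (r' *m w)) w : 'cV_(1 + L)) = col_mx 0 (B' *m w).
  by rewrite G1A mul_block_col -/r' -/B' mul1mx mul0mx addNr add0r.
by rewrite -H A1X !mulmxA -(mulmxA _ G1 X) mulVmx // mul1mx.
Qed.
End LocalElimination.

(** * Left multiplications that commute past a factor *)

Section Orbit.
Variable R : finComUnitRingType.

(** Since [Y X = 1], the space splits as the image of [X] plus the kernel of [Y]; [1 + X (G - 1) Y]
    acts as [G] on the first summand and trivially on the second, hence is multiplicative in [G]. *)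
Lemma embedGL_M (N r : nat) (X : 'M[R]_(N, r)) (Y : 'M[R]_(r, N)) (G H : 'M[R]_r) :
  Y *m X = 1%:M ->
  (1%:M + X *m (G - 1%:M) *m Y) *m (1%:M + X *m (H - 1%:M) *m Y) =
  1%:M + X *m (G *m H - 1%:M) *m Y.
Proof.
move=> YX; rewrite mulmxDl mul1mx mulmxDr mulmx1 -addrA; congr (_ + _).
have -> : X *m (G - 1%:M) *m Y *m (X *m (H - 1%:M) *m Y) =
          X *m ((G - 1%:M) *m (H - 1%:M)) *m Y.
  by rewrite !mulmxA -(mulmxA _ Y X) YX mulmx1.
rewrite -!mulmxDl -!mulmxDr; congr (_ *m _ *m _).
rewrite mulmxBr mulmx1 mulmxBl mul1mx.
by rewrite (addrC (G - 1%:M)) subrK addrC addrA subrK.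
Qed.

(* [U] is a product of two factors [1 + Z P A]; each commutes past [A] because
   [A (1 + Z P A) = (1 + A Z P) A]. *)
Lemma orbit_transport (L s N : nat) (A : 'M[R]_N) (P : 'M[R]_(L + s, N))
    (Q : 'M[R]_(N, L + s)) (G : 'M[R]_(L + s)) (M : 'M[R]_(N, L)) :
  P *m A *m Q = 1%:M -> G \in unitmx -> G *m (P *m A *m M) = col_mx 1%:M 0 ->
  exists U V : 'M[R]_N, [/\ U \in unitmx, V \in unitmx, A *m U = V *m A &
    U *m M = Q *m col_mx 1%:M 0].
Proof.
move=> PAQ GU GM.
pose T := P *m A; have TQ : T *m Q = 1%:M by [].
have PT : P *m (A *m Q) = 1%:M by rewrite mulmxA.
pose U1 H := 1%:M + Q *m (H - 1%:M) *m T.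
pose V1 H := 1%:M + A *m Q *m (H - 1%:M) *m P.
have U1M H H' : U1 H *m U1 H' = U1 (H *m H') by apply: embedGL_M.
have V1M H H' : V1 H *m V1 H' = V1 (H *m H') by apply: embedGL_M.
have U11 : U1 1%:M = 1%:M by rewrite /U1 subrr mulmx0 mul0mx addr0.
have V11 : V1 1%:M = 1%:M by rewrite /V1 subrr mulmx0 mul0mx addr0.
have U1U : U1 G \in unitmx.
  by case: (@mulmx1_unit _ _ (U1 G) (U1 (invmx G))); rewrite // U1M mulmxV.
have V1U : V1 G \in unitmx.
  by case: (@mulmx1_unit _ _ (V1 G) (V1 (invmx G))); rewrite // V1M mulmxV.
have TU1 : T *m (U1 G *m M) = col_mx 1%:M 0.
  rewrite -GM mulmxA /U1 mulmxDr mulmx1 !mulmxA TQ mul1mx.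
  rewrite -(mulmxA (G - 1%:M)) -/T mulmxBl mul1mx [X in X *m M](addrC T) subrK.
  by rewrite /T !mulmxA.
pose W := Q *m col_mx 1%:M 0 : 'M[R]_(N, L).
(* [W] and [U1 G M] have the same image under [T], so their difference is killed by [T]. [Z] sends
   the common image to this difference; [T Z = 0] makes [1 + Z T] invertible. *)
pose Z := (W - U1 G *m M) *m row_mx 1%:M (0 : 'M[R]_(L, s)).
have TZ : T *m Z = 0.
  rewrite /Z mulmxA mulmxBr TU1 /W mulmxA TQ mul1mx subrr mul0mx //.
have sq0 n (X Y : 'M[R]_n) : Y *m Y = 0 -> 1%:M + Y \in unitmx.
  move=> Y0; case: (@mulmx1_unit _ _ (1%:M + Y) (1%:M - Y)) => //.
  by rewrite mulmxBr mulmx1 mulmxDl mul1mx Y0 addr0 addrK.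
have AU1 : A *m U1 G = V1 G *m A.
  by rewrite /U1 /V1 mulmxDr mulmxDl mulmx1 mul1mx /T !mulmxA.
have AU2 : A *m (1%:M + Z *m T) = (1%:M + A *m Z *m P) *m A.
  by rewrite mulmxDr mulmxDl mulmx1 mul1mx /T !mulmxA.
exists ((1%:M + Z *m T) *m U1 G), ((1%:M + A *m Z *m P) *m V1 G); split.
- rewrite unitmx_mul U1U andbT; apply: sq0 => //.
  by rewrite mulmxA -(mulmxA Z T Z) TZ mulmx0 mul0mx.
- rewrite unitmx_mul V1U andbT; apply: sq0 => //.
  by rewrite -(mulmxA (A *m Z) P) (mulmxA P (A *m Z) P) (mulmxA P A Z) TZ mul0mx mulmx0.
- by rewrite mulmxA AU2 -mulmxA AU1 mulmxA.
- rewrite -mulmxA mulmxDl mul1mx -mulmxA TU1 /Z -mulmxA mul_row_col mulmx1 mul0mx.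
  by rewrite addr0 mulmx1 addrC subrK.
Qed.
End Orbit.

(** * Laws of linear forms *)

Section LinearForms.
Variables (F : realType) (R : finComUnitRingType) (xi : R -> F).

(** Convolution with the law of [h x], for [x] of law [xi]. Hence [avgs s mass0] is the law of the
    linear form with coefficients [s] in independent variables of law [xi]. *)
Definition avg (h : R) (f : R -> F) : R -> F :=
  fun t => \sum_x xi x * f (t - h * x).

Definition avgs (s : seq R) (f : R -> F) : R -> F := foldr avg f s.

Definition mass0 : R -> F := fun t => (t == 0)%:R.

Lemma avgC h h' f : avg h (avg h' f) = avg h' (avg h f).
Proof.
apply/funext => t; rewrite /avg.
under eq_bigr => x _ do rewrite mulr_sumr.
rewrite exchange_big /=; apply: eq_bigr => y _; rewrite mulr_sumr.
by apply: eq_bigr => x _; rewrite mulrCA addrAC.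
Qed.

Lemma avgs_cons h s f : avgs (h :: s) f = avg h (avgs s f).
Proof. by []. Qed.

Lemma avgs_cat s s' f : avgs (s ++ s') f = avgs s (avgs s' f).
Proof. exact: foldr_cat. Qed.

Lemma avgs_avg s h f : avgs s (avg h f) = avg h (avgs s f).
Proof. by elim: s => //= h' s ->; rewrite avgC. Qed.

Lemma avgs_avgs s s' f : avgs s (avgs s' f) = avgs s' (avgs s f).
Proof. by elim: s => //= h s ->; rewrite avgs_avg. Qed.

Lemma avgs_perm s s' f : perm_eq s s' -> avgs s f = avgs s' f.
Proof.
move=> ss'; apply/esym.
apply: (catCA_perm_ind (P := fun r => avgs r f = avgs s f) _ ss') => //.
by move=> s1 s2 s3; rewrite !avgs_cat avgs_avgs.
Qed.

Lemma avgs_conv s f t : avgs s f t = \sum_y avgs s mass0 y * f (t - y).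
Proof.
elim: s t => [|h s IH] t.
  rewrite (bigD1 0) //= big1 ?addr0 /mass0 ?eqxx ?mul1r ?subr0 // => y /negbTE ->.
  by rewrite mul0r.
rewrite avgs_cons /avg; under eq_bigr => x _ do rewrite IH mulr_sumr.
under [RHS]eq_bigr => y _ do rewrite mulr_suml.
rewrite [RHS]exchange_big /=; apply: eq_bigr => x _.
rewrite [RHS](reindex_inj (addIr (h * x))) /=.
by apply: eq_bigr => y _; rewrite addrK mulrA opprD addrA addrAC.
Qed.

Hypothesis xi_distr : is_distribution xi.
Let xi_ge0 x : 0 <= xi x. Proof. by case: xi_distr. Qed.
Let xi_sum : \sum_x xi x = 1. Proof. by case: xi_distr. Qed.

Lemma avgs_le s f c : (forall t, f t <= c) -> forall t, avgs s f t <= c.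
Proof.
move=> fc; elim: s => // h s IH t; rewrite avgs_cons /avg.
by rewrite -[leRHS]mul1r -xi_sum mulr_suml ler_sum // => x _; rewrite ler_wpM2l.
Qed.

Lemma avgs_ge s f c : (forall t, c <= f t) -> forall t, c <= avgs s f t.
Proof.
move=> fc; elim: s => // h s IH t; rewrite avgs_cons /avg.
by rewrite -[leLHS]mul1r -xi_sum mulr_suml ler_sum // => x _; rewrite ler_wpM2l.
Qed.

Lemma mass0_ge0 t : 0 <= mass0 t. Proof. exact: ler0n. Qed.

Lemma law_ge0 s t : 0 <= avgs s mass0 t.
Proof. exact/avgs_ge/mass0_ge0. Qed.

Lemma law_sum s : \sum_y avgs s mass0 y = 1.
Proof.
have /(_ 0) := avgs_conv s (fun=> 1).
under eq_bigr do rewrite mulr1.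
move=> <-; apply/eqP; rewrite eq_le; apply/andP; split.
  exact: (@avgs_le s (fun=> 1) 1).
exact: (@avgs_ge s (fun=> 1) 1).
Qed.

(** * Contraction along the cosets of an additive subgroup *)

Section Contraction.
Variable T : {set R}.
Hypothesis Tz : zmod_closed T.
Let T0 : 0 \in T. Proof. by case: Tz. Qed.
Let TB : {in T &, forall x y, x - y \in T}. Proof. by case: Tz. Qed.
Let TN x : x \in T -> - x \in T. Proof. by move=> xT; rewrite -sub0r TB. Qed.
Let TD x y : x \in T -> y \in T -> x + y \in T.
Proof. by move=> xT yT; rewrite -[y]opprK TB // TN. Qed.

(** Oscillation along the cosets of [T]. The one-sided inequality suffices: replacing [t] by [t - u]
    and [u] by [- u] gives the other side. *)
Definition osc_le (D : F) (f : R -> F) :=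
  forall t u, u \in T -> f t <= f (t - u) + D.

(* Doeblin's argument: a common part of mass [beta] of the two laws can be
   coupled. *)
Lemma osc_contract s beta D f :
  (forall y, y \in T -> beta <= avgs s mass0 y) ->
  (forall y, y \notin T -> avgs s mass0 y = 0) ->
  osc_le D f -> osc_le ((1 - beta) * D) (avgs s f).
Proof.
move=> pT pN fD t u uT; set p := avgs s mass0 in pT pN.
have [y0 y0T ymin] : exists2 y0, y0 \in T & forall y, y \in T -> f (t - y0) <= f (t - y).
  case: (arg_minP (fun y => f (t - y)) T0) => y0 y0T ymin.
  by exists y0.
pose b := f (t - y0).
have fle y : y \in T -> f (t - y) <= b + D.
  move=> yT; have := fD (t - y) (y0 - y) (TB y0T yT).
  by rewrite opprB addrA subrK.
(* A mass [beta] is set aside at [v]. With [v = u] in the mean at [t] and [v = 0] in the mean at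
   [t - u], both parts evaluate [f] at [t - u] and cancel; the remaining mass [1 - beta] sees values
   between [b] and [b + D]. *)
have split_at v g : v \in T -> \sum_y p y * g y =
    beta * g v + \sum_(y in T) (p y - beta * (y == v)%:R) * g y.
  move=> vT; rewrite (bigID (mem T)) /= [X in _ + X]big1 ?addr0; last first.
    by move=> y /pN ->; rewrite mul0r.
  under [in RHS]eq_bigr do rewrite mulrBl.
  rewrite sumrB addrC -addrA -[LHS]addr0; congr (_ + _); apply/esym.
  rewrite (bigD1 v) //= eqxx mulr1 big1 ?addr0 ?addNr // => y /andP[_ /negbTE->].
  by rewrite mulr0 mul0r.
have mass v : v \in T -> \sum_(y in T) (p y - beta * (y == v)%:R) = 1 - beta.
  move=> vT; have := split_at v (fun=> 1) vT.
  under eq_bigr do rewrite mulr1; rewrite law_sum mulr1.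
  under eq_bigr do rewrite mulr1.
  by move/(canLR (addKr _)) => <-; rewrite addrC.
have wge0 v y : v \in T -> y \in T -> 0 <= p y - beta * (y == v)%:R.
  move=> vT yT; have [->|_] := eqVneq; first by rewrite mulr1 subr_ge0 pT.
  by rewrite mulr0 subr0 law_ge0.
rewrite !avgs_conv -/p (split_at u _ uT) (split_at 0 _ T0) subr0 -addrA lerD2l.
have -> : (1 - beta) * D = (1 - beta) * (b + D) - (1 - beta) * b.
  by rewrite mulrDr addrAC subrr add0r.
have le1 : \sum_(y in T) (p y - beta * (y == u)%:R) * f (t - y) <= (1 - beta) * (b + D).
  rewrite -(mass u uT) mulr_suml ler_sum // => y yT.
  by rewrite ler_wpM2l ?wge0 ?fle.
have le2 : (1 - beta) * b <= \sum_(y in T) (p y - beta * (y == 0)%:R) * f (t - u - y).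
  rewrite -(mass 0 T0) mulr_suml ler_sum // => y yT.
  rewrite ler_wpM2l ?wge0 //.
  by have := ymin _ (TD uT yT); rewrite opprD addrA.
by lra.
Qed.

Lemma osc_blocks s beta l f :
  (forall y, y \in T -> beta <= avgs s mass0 y) ->
  (forall y, y \notin T -> avgs s mass0 y = 0) ->
  osc_le 1 f -> osc_le ((1 - beta) ^+ l) (avgs (flatten (nseq l s)) f).
Proof.
move=> pT pN f1; elim: l => [|l IH] /=; first by rewrite expr0.
by rewrite exprS avgs_cat; apply: osc_contract.
Qed.

(** After [l] contractions the law is nearly constant on each coset of [T], so an atom is close to
    the mass of its coset divided by [#|T|]. *)
Lemma law_coset_bound w s beta l r b :
  (forall y, y \in T -> beta <= avgs s mass0 y) ->
  (forall y, y \notin T -> avgs s mass0 y = 0) ->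
  perm_eq w (flatten (nseq l s) ++ r) ->
  (forall t, \sum_(u in T) avgs w mass0 (t - u) <= b) ->
  forall t, avgs w mass0 t <= b / #|T|%:R + (1 - beta) ^+ l.
Proof.
move=> pT pN /(avgs_perm mass0); rewrite avgs_cat => wE wb t.
have Tgt0 : 0 < #|T|%:R :> F by rewrite ltr0n; apply/card_gt0P; exists 0.
have osc : osc_le ((1 - beta) ^+ l) (avgs w mass0).
  rewrite wE; apply: (osc_blocks l pT pN) => {}t u uT.
  rewrite (@le_trans _ _ 1) ?lerDr ?law_ge0 //.
  by apply: avgs_le => y; rewrite /mass0 lern1 leq_b1.
rewrite -(ler_pM2r Tgt0) mulrDl divfK ?gt_eqF //.
apply: (@le_trans _ _ (\sum_(u in T) (avgs w mass0 (t - u) + (1 - beta) ^+ l))).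
  rewrite mulr_natr -sumr_const ler_sum // => u uT; exact: osc.
by rewrite big_split /= sumr_const mulr_natr lerD2r wb.
Qed.

Lemma coset_mass_le1 w t : \sum_(u in T) avgs w mass0 (t - u) <= 1.
Proof.
rewrite -(law_sum w) [leRHS](reindex_inj (inj_comp (addrI t) oppr_inj)) /=.
rewrite [leRHS](bigID (mem T)) /= lerDl sumr_ge0 // => u _; exact: law_ge0.
Qed.

(** Fix all the variables but one whose coefficient is [v]. As [v] is not in [T], the values 0 and 1
    of that variable cannot both put the form into the given coset, so a mass of at least [c] misses
    it. *)
Lemma coset_mass_unit w v c t : v \in w -> v \notin T ->
  c <= xi 0 -> c <= xi 1 -> \sum_(u in T) avgs w mass0 (t - u) <= 1 - c.
Proof.
move=> vw vT c0 c1.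
have sumE (f : R -> F) h s : (fun t => \sum_(u in T) avgs s (avg h f) (t - u)) =
   avgs s (fun t => \sum_(u in T) avg h f (t - u)).
  elim: s => //= h' s <-; apply/funext => z; rewrite /avg exchange_big /=.
  apply: eq_bigr => x _; rewrite mulr_sumr; apply: eq_bigr => u _.
  by rewrite addrAC.
rewrite (avgs_perm _ (perm_to_rem vw)) /= -avgs_avg.
have -> := congr1 (fun g => g t) (sumE mass0 v (rem v w)).
apply: avgs_le => z; rewrite /avg exchange_big /=.
have cosE x : \sum_(u in T) xi x * mass0 (z - u - v * x) = xi x * (z - v * x \in T)%:R.
  rewrite -mulr_sumr; congr (_ * _); have [zT|zT] := boolP (_ \in T).
    rewrite (bigD1 (z - v * x)) //= big1 ?addr0.
      by rewrite /mass0 addrAC subrr eqxx.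
    move=> u /andP[_ uN]; rewrite /mass0 addrAC subr_eq0 eq_sym.
    by rewrite (negbTE uN).
  rewrite big1 // => u uT; rewrite /mass0 addrAC subr_eq0.
  by case: eqP => // zu; rewrite zu uT in zT.
under eq_bigr do rewrite cosE.
have [x0 cx0 x0N] : exists2 x0, c <= xi x0 & z - v * x0 \notin T.
  have [zT|zT] := boolP (z \in T); last by exists 0; rewrite ?mulr0 ?subr0.
  exists 1 => //; rewrite mulr1; apply: contra vT => zvT.
  by rewrite -[v](subKr z) TB.
rewrite (bigD1 x0) //= (negbTE x0N) mulr0 add0r -[X in _ <= X - c]xi_sum.
rewrite [X in _ <= X - c](bigD1 x0) //= addrAC.
apply: (@le_trans _ _ (\sum_(i | i != x0) xi i)); last by rewrite lerDr subr_ge0.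
by apply: ler_sum => x _; rewrite ler_piMr ?xi_ge0 ?lern1 ?leq_b1.
Qed.

End Contraction.
End LinearForms.

(** * Additive subgroups of the ring *)

Section AdditiveSpan.
Variable R : finComUnitRingType.

(** The group structure carried by a finite ring is the additive one, so the generated subgroup is
    the additive span. *)
Definition addspan (A : {set R}) : {set R} := <<A>>%g.

Lemma addspan_zmod_closed (A : {set R}) : zmod_closed (addspan A).
Proof.
split; first exact: (group1 <<A>>%G).
by move=> x y xA yA; apply: (groupM xA); rewrite groupV.
Qed.

Lemma sub_addspan (A : {set R}) : A \subset addspan A.
Proof. exact: subset_gen. Qed.

Lemma addspanP (A : {set R}) (x : R) : x \in addspan A ->
  exists2 s : seq R, {subset s <= A} & x = \sum_(y <- s) y.
Proof.
case/gen_prodgP => n [c cA ->]; exists [seq c i | i <- enum 'I_n].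
  by move=> y /mapP[i _ ->].
by rewrite big_map big_enum.
Qed.

Lemma addspan_min (A S : {set R}) : zmod_closed S -> A \subset S -> addspan A \subset S.
Proof.
move=> Sz /fintype.subsetP AS; apply/fintype.subsetP => x /addspanP[s sA ->].
have [S0 SB] := Sz; have SD := GRing.zmod_closedD Sz.
elim: s sA => [|y s IH] sA; first by rewrite big_nil.
rewrite big_cons; apply: (SD.2).
  by apply/AS/sA; rewrite inE eqxx.
by apply: IH => z zs; apply: sA; rewrite inE zs orbT.
Qed.

Lemma addspan_mulS (A B C : {set R}) :
  [set a * b | a in A, b in B] \subset addspan C ->
  forall h x, h \in addspan A -> x \in B -> h * x \in addspan C.
Proof.
move=> /fintype.subsetP ABC h x /addspanP[s sA ->] xB; rewrite mulr_suml.
have SD := GRing.zmod_closedD (addspan_zmod_closed C).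
elim: s sA => [|y s IH] sA; first by rewrite big_nil; apply: (SD.1).
rewrite big_cons; apply: (SD.2).
  by apply/ABC/imset2_f => //; apply: sA; rewrite inE eqxx.
by apply: IH => z zs; apply: sA; rewrite inE zs orbT.
Qed.

End AdditiveSpan.

Lemma perm_count_le (T : eqType) (s w : seq T) :
  (forall x, (count_mem x s <= count_mem x w)%N) -> exists r, perm_eq w (s ++ r).
Proof.
elim: s w => [|y s IH] w le_sw; first by exists w.
have yw : y \in w.
  by rewrite -has_pred1 has_count (leq_trans _ (le_sw y)) //= eqxx.
have wE := perm_to_rem yw.
have [x|r rP] := IH (rem y w).
  by have := le_sw x; rewrite (seq.permP wE) /= leq_add2l.
by exists r; rewrite (perm_trans wE) //= perm_cons.
Qed.

Lemma count_flatten_nseq (T : Type) (a : pred T) n (s : seq T) :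
  count a (flatten (nseq n s)) = (n * count a s)%N.
Proof. by elim: n => //= n IH; rewrite count_cat IH mulSn. Qed.

Lemma nat_finite_bound (I : finType) (Q : I -> nat -> Prop) :
  (forall i m n, (m <= n)%N -> Q i m -> Q i n) ->
  (forall i, exists n, Q i n) -> exists n, forall i, Q i n.
Proof.
move=> Qmono /choice[f fQ]; exists (\max_i f i)%N => i.
exact/(Qmono _ _ _ _ (fQ i))/leq_bigmax.
Qed.

Lemma pos_finite_bound (F : realType) (I : finType) (P : pred I) (f : I -> F) :
  (forall i, P i -> 0 < f i) ->
  exists b : F, [/\ 0 < b, b <= 1 & forall i, P i -> b <= f i].
Proof.
(* The default value 1 covers the empty case and keeps the bound at most 1. *)
move=> f0; exists (\big[Order.min/1]_(i | P i) f i); split.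
- by apply/bigmin_gtP; split; rewrite ?ltr01.
- exact: bigmin_le_id.
- by move=> i Pi; exact: bigmin_le_cond.
Qed.

(** * Atoms of a linear form and the span of its frequent coefficients *)

Section ConcentrationBound.
Variables (F : realType) (R : finComUnitRingType) (xi : R -> F).
Hypothesis xi_distr : is_distribution xi.
Let xi_ge0 x : 0 <= xi x. Proof. by case: xi_distr. Qed.
Let xi_sum : \sum_x xi x = 1. Proof. by case: xi_distr. Qed.
Hypothesis xi0 : 0 < xi 0.
Local Notation supp := (support_of xi).
Local Notation mass0 := (@mass0 F R).

(** The additive group spanned by the possible terms of a form with coefficients in [P]. It plays
    the part of [T] above, while [addspan P] is the span of the coefficients alone. *)
Definition formspan (P : {set R}) := addspan [set h * x | h in P, x in supp].
Definition blocks n (P : {set R}) := flatten (nseq n (enum P)).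

Lemma count_blocks n (P : {set R}) h : count_mem h (blocks n P) = (n * (h \in P))%N.
Proof.
by rewrite /blocks count_flatten_nseq count_uniq_mem ?enum_uniq // mem_enum.
Qed.

Lemma avg_pos h (g : R -> F) t x : (forall u, 0 <= g u) -> x \in supp ->
  0 < g (t - h * x) -> 0 < avg xi h g t.
Proof.
move=> g0 xs gt0; rewrite /avg (bigD1 x) //= ltr_wpDr ?sumr_ge0 //.
  by move=> y _; rewrite mulr_ge0.
by rewrite mulr_gt0 // lt_def xi_ge0 andbT; rewrite inE in xs.
Qed.

Lemma supp0 : 0 \in supp. Proof. by rewrite inE gt_eqF. Qed.

Lemma avgs_pos_stay s (g : R -> F) t : (forall u, 0 <= g u) -> 0 < g t -> 0 < avgs xi s g t.
Proof.
move=> g0 gt; elim: s => // h s IH; rewrite avgs_cons.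
apply: (@avg_pos _ _ _ 0); rewrite ?supp0 //; last by rewrite mulr0 subr0.
exact: avgs_ge.
Qed.

Lemma avgs_pos_move s (g : R -> F) t h x : (forall u, 0 <= g u) -> h \in s ->
  x \in supp -> 0 < g (t - h * x) -> 0 < avgs xi s g t.
Proof.
move=> g0 hs xs gt; rewrite (avgs_perm _ _ (perm_to_rem hs)) avgs_cons -avgs_avg.
apply: avgs_pos_stay; last exact: (avg_pos g0 xs gt).
by move=> u; apply: (avgs_ge xi_distr [:: h]).
Qed.

(** Each summand uses up one copy of [P]: one variable of the copy takes the required value and the
    others take the value 0, which has positive mass. *)
Lemma blocks_pos (P : {set R}) n (s : seq R) :
  {subset s <= [set h * x | h in P, x in supp]} -> (size s <= n)%N ->
  0 < avgs xi (blocks n P) mass0 (\sum_(y <- s) y).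
Proof.
elim: n s => [|n IH] [|z s] // zsP sn.
- by rewrite big_nil /= /mass0 eqxx ltr01.
- rewrite big_nil; apply: avgs_pos_stay; first exact: mass0_ge0.
  by rewrite /mass0 eqxx.
have /imset2P[h x hP xs zE] : z \in [set h * x | h in P, x in supp].
  by apply: zsP; rewrite inE eqxx.
rewrite /blocks /= avgs_cat big_cons zE; apply: (@avgs_pos_move _ _ _ h x) => //.
- exact: law_ge0.
- by rewrite mem_enum.
rewrite addrAC subrr add0r; apply: IH => // y ys.
by apply: zsP; rewrite inE ys orbT.
Qed.

Lemma law_off (T : {set R}) s : zmod_closed T ->
  (forall h x, h \in s -> x \in supp -> h * x \in T) ->
  forall y, y \notin T -> avgs xi s mass0 y = 0.
Proof.
move=> Tz; have TD := (GRing.zmod_closedD Tz).2.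
elim: s => [|h s IH] hT y yT.
  rewrite /= /mass0; case: eqP yT => // ->; by case: Tz => ->.
rewrite avgs_cons /avg big1 // => x _.
have [xs|] := boolP (x \in supp); last by rewrite inE negbK => /eqP->; rewrite mul0r.
rewrite IH ?mulr0 // => [h' x' h's x's|]; first by apply: hT; rewrite // inE h's orbT.
apply: contra yT => yT; rewrite -(subrK (h * x) y); apply: TD => //.
by apply: hT; rewrite // inE eqxx.
Qed.

(** There are only finitely many pairs of a set [P] and a point [y], so one number of copies and one
    lower bound serve them all; extra copies do no harm, because 0 is in the support. *)
Lemma blocks_uniform : exists (n : nat) (beta : F), [/\ 0 < beta, beta <= 1 &
  forall (P : {set R}) y, y \in formspan P -> beta <= avgs xi (blocks n P) mass0 y].
Proof.
have [n nP] : exists n, forall i : {set R} * R, i.2 \in formspan i.1 ->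
    exists2 s, {subset s <= [set h * x | h in i.1, x in supp]} &
       i.2 = \sum_(y <- s) y /\ (size s <= n)%N.
  apply: (nat_finite_bound (Q := fun i n => i.2 \in formspan i.1 ->
    exists2 s, {subset s <= [set h * x | h in i.1, x in supp]} &
       i.2 = \sum_(y <- s) y /\ (size s <= n)%N)).
    move=> i m n mn H /H[s sP [? sm]]; exists s => //; split=> //.
    exact: leq_trans mn.
  move=> [P y] /=; have [|yN] := boolP (y \in formspan P); last by exists 0%N.
  by case/addspanP => s sP yE; exists (size s) => _; exists s.
have [|b [b0 b1 bP]] := @pos_finite_bound F ({set R} * R)%type
   (fun i => i.2 \in formspan i.1) (fun i => avgs xi (blocks n i.1) mass0 i.2).
  by move=> i /nP[s sP [-> sn]]; apply: blocks_pos.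
by exists n, b; split=> // P y yP; apply: (bP (P, y)).
Qed.

Hypothesis xi1 : 0 < xi 1.
Hypothesis xi_gen : forall S : {set R}, subring_closed S -> supp \subset S -> S = [set: R].

Lemma supp1 : 1 \in supp. Proof. by rewrite inE gt_eqF. Qed.

Lemma addspan_sub_formspan P : addspan P \subset formspan P.
Proof.
apply: addspan_min; first exact: addspan_zmod_closed.
apply/fintype.subsetP => h hP; apply: (fintype.subsetP (sub_addspan _)).
by rewrite -[h]mulr1 imset2_f // supp1.
Qed.

(* The multiplier ring of [addspan P] contains the support, hence is all of
   [R]. *)
Lemma formspan_eq_ideal P : formspan P = addspan P ->
  forall r h, h \in addspan P -> r * h \in addspan P.
Proof.
move=> TH; have [H0 HB] := addspan_zmod_closed P.
pose S := [set r : R | [forall h in addspan P, r * h \in addspan P]].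
have SP r : reflect (forall h, h \in addspan P -> r * h \in addspan P) (r \in S).
  by rewrite inE; apply: (iffP forall_inP).
suff ST : S = [set: R] by move=> r; apply/SP; rewrite ST inE.
apply: xi_gen.
  split; first by apply/SP => h; rewrite mul1r.
    move=> x y /SP xS /SP yS; apply/SP => h hP.
    by rewrite mulrBl HB ?xS ?yS.
  by move=> x y /SP xS /SP yS; apply/SP => h hP; rewrite -mulrA xS ?yS.
apply/fintype.subsetP => x xs; apply/SP => h hP; rewrite mulrC -TH.
by apply: (@addspan_mulS _ P supp) => //; apply: sub_addspan.
Qed.

Definition frequent m (w : seq R) : {set R} := [set h | (m <= count_mem h w)%N].

Lemma concentration_bound : exists (n : nat) (gam theta : F),
  [/\ 0 <= gam < 1, 0 <= theta < 1 & forall l w, let P := frequent (n * l) w in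
   [/\ addspan P = [set: R] -> forall t, avgs xi w mass0 t <= #|R|%:R^-1 + gam ^+ l
     & addspan P != [set: R] -> has (mem GRing.unit) w ->
       forall t, avgs xi w mass0 t <= theta / #|addspan P|%:R + gam ^+ l]].
Proof.
have [n [beta [b0 b1 bP]]] := blocks_uniform.
pose c := Order.min (xi 0) (xi 1); pose q : F := #|R|%:R.
have c_gt0 : 0 < c by rewrite lt_min xi0 xi1.
have c_le1 : c <= 1.
  rewrite (@le_trans _ _ (xi 0)) ?ge_min ?lexx // -xi_sum (bigD1 0) //= lerDl.
  exact: sumr_ge0.
have q_gt0 : 0 < q by rewrite ltr0n; apply/card_gt0P; exists 0.
(* [1 - c] serves when [formspan P = addspan P]. Otherwise [formspan P] has at least [h + 1]
   elements, with [h = #|addspan P|], and [1 / (h + 1)] is at most [q / (q + 1) / h] because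
   [h <= q]. *)
exists n, (1 - beta), (Order.max (1 - c) (q / (q + 1))); split.
- by apply/andP; split; lra.
- rewrite le_max gt_max ltr_pdivrMr; last by lra.
  by apply/andP; split; [apply/orP; left; lra | apply/andP; split; lra].
move=> l w P; have Tz := addspan_zmod_closed [set h * x | h in P, x in supp].
(* An element of [P] occurs at least [n * l] times in [w], so [w] contains [l] disjoint blocks, each
   of which contracts by [1 - beta]. *)
have [r wr] : exists r, perm_eq w (flatten (nseq l (blocks n P)) ++ r).
  apply: perm_count_le => x.
  have -> : count_mem x (flatten (nseq l (blocks n P))) = (n * l * (x \in P))%N.
    by rewrite count_flatten_nseq count_blocks mulnA (mulnC l).
  by case: (boolP (x \in P)); rewrite ?muln0 // muln1 inE.
have offT y : y \notin formspan P -> avgs xi (blocks n P) mass0 y = 0.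
  apply: law_off => // h x hb xs; apply: (fintype.subsetP (sub_addspan _)).
  apply: imset2_f => //; rewrite -has_pred1 has_count count_blocks in hb.
  by move: hb; case: (h \in P); rewrite ?muln0.
have coset_bound b := @law_coset_bound F R xi xi_distr _ Tz w _ _ l r b (bP P) offT wr.
have HT := addspan_sub_formspan P.
have hn0 : (0 < #|addspan P|)%N.
  by apply/card_gt0P; exists 0; case: (addspan_zmod_closed P).
split=> [HR t | HR /hasP[v vw vU] t].
  have -> : #|R|%:R^-1 = 1 / #|formspan P|%:R :> F.
    by rewrite -cardsT -HR div1r; congr (_%:R^-1); apply/eqP;
       rewrite eqn_leq subset_leq_card //= HR cardsT max_card.
  by apply: coset_bound => {}t; apply: coset_mass_le1.
have [TH|TH] := eqVneq (formspan P) (addspan P).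
  apply: (@le_trans _ _ ((1 - c) / #|formspan P|%:R + (1 - beta) ^+ l)).
    apply: coset_bound => {}t; apply: (@coset_mass_unit _ _ _ _ _ _ _ v) => //.
    - change (v \notin formspan P); rewrite TH; apply: contra HR => vP.
      apply/eqP/setP => x; rewrite inE -[x](divrK vU).
      exact: formspan_eq_ideal.
    - by rewrite ge_min lexx.
    - by rewrite ge_min lexx orbT.
  by rewrite TH lerD2r ler_wpM2r ?invr_ge0 ?ler0n // le_max lexx.
have {}TH : (#|addspan P| < #|formspan P|)%N.
  by apply: proper_card; rewrite finset.properEneq eq_sym TH.
apply: (@le_trans _ _ (1 / #|formspan P|%:R + (1 - beta) ^+ l)).
  by apply: coset_bound => {}t; apply: coset_mass_le1.
rewrite lerD2r; set h : F := #|addspan P|%:R.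
have h0 : 0 < h by rewrite ltr0n.
have hq : h <= q by rewrite ler_nat max_card.
apply: (@le_trans _ _ (1 / (h + 1))).
  rewrite ler_pM2l // lef_pV2 ?posrE //; [|by rewrite ltr0n (leq_trans _ TH)|lra].
  by rewrite /h natr1 ler_nat.
apply: (@le_trans _ _ (q / (q + 1) / h)).
  rewrite ler_pdivlMr // mulrAC ler_pdivrMr; last by lra.
  by rewrite mul1r mulrAC ler_pdivlMr; [nra|lra].
by rewrite ler_wpM2r ?invr_ge0 ?(ltW h0) // le_max lexx orbT.
Qed.

End ConcentrationBound.

(** * Geometric decay *)

Section GeometricDecay.
Variable F : realType.
Implicit Types (e : nat -> F) (r : F).

(** Only an upper bound is imposed on [e]; [r] is positive so that its logarithm can serve as the
    final rate. *)
Definition geo e :=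
  exists K r, [/\ 0 <= K, 0 < r < 1 & forall N, e N <= K * r ^+ N].

Lemma geo_le e e' : (forall N, e N <= e' N) -> geo e' -> geo e.
Proof.
move=> ee' [K [r [K0 r01 e'P]]]; exists K, r; split=> // N.
exact: le_trans (e'P N).
Qed.

Lemma geoD e e' : geo e -> geo e' -> geo (fun N => e N + e' N).
Proof.
move=> [K [r [K0 /andP[r0 r1] eP]]] [K' [r' [K'0 /andP[r'0 r'1] e'P]]].
exists (K + K'), (Order.max r r'); split; first by rewrite addr_ge0.
  by rewrite lt_max r0 gt_max r1 r'1.
have rm : r <= Order.max r r' by rewrite le_max lexx.
have r'm : r' <= Order.max r r' by rewrite le_max lexx orbT.
have m0 : 0 <= Order.max r r' := le_trans (ltW r0) rm.
move=> N; rewrite mulrDl lerD //.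
  by rewrite (le_trans (eP N)) // ler_wpM2l // lerXn2r // nnegrE ltW.
by rewrite (le_trans (e'P N)) // ler_wpM2l // lerXn2r // nnegrE ltW.
Qed.

Lemma geoZ e c : 0 <= c -> geo e -> geo (fun N => c * e N).
Proof.
move=> c0 [K [r [K0 r01 eP]]]; exists (c * K), r; split=> //; first exact: mulr_ge0.
by move=> N; rewrite -mulrA ler_wpM2l.
Qed.

Lemma geo_finite c N0 : 0 <= c -> geo (fun N => c * (N < N0)%N%:R).
Proof.
move=> c0; exists (c * 2 ^+ N0), (2^-1); split; first by rewrite mulr_ge0 // exprn_ge0.
  by apply/andP; split; lra.
move=> N; rewrite -mulrA ler_wpM2l // exprVn ler_pdivlMr ?exprn_gt0 //.
have [NN0|_] := ltnP; last by rewrite mul0r exprn_ge0.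
rewrite mul1r; apply: ler_weXn2l; [by lra | exact: ltnW].
Qed.

(** Bernoulli's inequality: if [b x = (1 - r) / 2], then [(1 - x) ^ b >= 1 - b x = (1 + r) / 2 >=
    r]. *)
Lemma root_near1 r (b : nat) : 0 <= r < 1 -> (0 < b)%N ->
  exists2 s : F, 0 < s < 1 & r <= s ^+ b.
Proof.
move=> /andP[r0 r1] b0.
pose x := (1 - r) / (2 * b%:R).
have bF : 1 <= b%:R :> F by rewrite ler1n.
have x0 : 0 < x by rewrite divr_gt0 ?subr_gt0 // mulr_gt0 //; lra.
have xb : x * b%:R = (1 - r) / 2 by rewrite /x; field; lra.
have xle : x <= (1 - r) / 2 by rewrite -xb ler_peMr // ltW.
exists (1 - x); first by apply/andP; split; lra.
suff B n : 1 - n%:R * x <= (1 - x) ^+ n by have := B b; rewrite mulrC xb; lra.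
elim: n => [|n IH]; first by rewrite mul0r subr0 expr0.
rewrite exprS -natr1; have n0 : 0 <= n%:R :> F by [].
apply: (@le_trans _ _ ((1 - x) * (1 - n%:R * x))); last by rewrite ler_wpM2l //; lra.
have : 0 <= n%:R * (x * x) by rewrite -expr2 mulr_ge0 ?sqr_ge0.
by lra.
Qed.

Lemma geo_divn r (b : nat) : 0 <= r < 1 -> (0 < b)%N -> geo (fun N => r ^+ (N %/ b)).
Proof.
move=> r01 b0; have [s /andP[s0 s1] rs] := root_near1 r01 b0.
(* The constant [s ^- b] pays for the remainder of the division of [N] by [b]. *)
exists (s ^- b), s; split; rewrite ?s0 ?s1 // ?invr_ge0 ?exprn_ge0 ?(ltW s0) //.
move=> N; rewrite mulrC ler_pdivlMr ?exprn_gt0 //.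
apply: (@le_trans _ _ ((s ^+ b) ^+ (N %/ b) * s ^+ b)).
  rewrite ler_wpM2r ?exprn_ge0 ?(ltW s0) // lerXn2r // ?nnegrE ?exprn_ge0 ?(ltW s0) //.
  by case/andP: r01.
rewrite -exprM -exprD ler_wiXn2l ?(ltW s0) ?(ltW s1) //.
by rewrite {1}(divn_eq N b) mulnC leq_add2l ltnW // ltn_mod.
Qed.

(** The rate is weakened from [r] to [s = r (1 + d)], and Bernoulli's inequality gives
    [N <= (1 + d) ^ N / d]. *)
Lemma geo_natM e : geo e -> geo (fun N => N%:R * e N).
Proof.
move=> [K [r [K0 /andP[r0 r1] eP]]].
pose s := (1 + r) / 2; pose d := s / r - 1.
have s0 : 0 < s by rewrite /s; lra.
have d0 : 0 < d by rewrite subr_gt0 ltr_pdivlMr // /s; lra.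
exists (K / d), s; split; first by rewrite divr_ge0 // ltW.
  by rewrite s0 /s; lra.
move=> N; apply: (@le_trans _ _ (N%:R * (K * r ^+ N))).
  by rewrite ler_wpM2l.
have B n : 1 + n%:R * d <= (1 + d) ^+ n.
  elim: n => [|n IH]; first by rewrite mul0r addr0 expr0.
  rewrite exprS -natr1; have n0 : 0 <= n%:R :> F by [].
  apply: (@le_trans _ _ ((1 + d) * (1 + n%:R * d))); last by rewrite ler_wpM2l //; lra.
  have : 0 <= n%:R * (d * d) by rewrite -expr2 mulr_ge0 ?sqr_ge0.
  by lra.
have -> : s ^+ N = r ^+ N * (1 + d) ^+ N.
  by rewrite -exprMn; congr (_ ^+ _); rewrite /d addrCA subrr addr0 mulrC divfK // gt_eqF.
have -> : K / d * (r ^+ N * (1 + d) ^+ N) = K * r ^+ N * ((1 + d) ^+ N / d) by ring.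
rewrite mulrC; apply: ler_wpM2l; first by rewrite mulr_ge0 ?exprn_ge0 ?(ltW r0).
by rewrite ler_pdivlMr //; apply: le_trans (B N); rewrite lerDr.
Qed.

Lemma geo_bounded e : geo e -> exists2 C, 0 <= C & forall N, e N <= C.
Proof.
move=> [K [r [K0 /andP[r0 r1] eP]]]; exists K => // N.
by rewrite (le_trans (eP N)) // ler_piMr // exprn_ile1 ?ltW.
Qed.

(** [N * e N] is bounded by some [C], hence [e N <= C / N]. *)
Lemma geo_small e (eps : F) : geo e -> 0 < eps ->
  exists N0, forall N, (N0 <= N)%N -> e N <= eps.
Proof.
move=> /geo_natM/geo_bounded[C C0 eC] eps0.
exists (Num.bound (C / eps)).+1 => N nN.
have N0 : 0 < N%:R :> F by rewrite ltr0n (leq_ltn_trans _ nN).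
rewrite -(ler_pM2l N0) (le_trans (eC N)) // -ler_pdivrMr // ltW //.
rewrite (lt_le_trans (archi_boundP _)) ?divr_ge0 ?(ltW eps0) //.
by rewrite ler_nat ltnW.
Qed.

(** With [y = N * x N], which decays and is bounded by [C]: [(1 + x N) ^ N - 1 <= exp y - 1 <= y *
    exp y <= y * exp C]. *)
Lemma geo_exp1D (x : nat -> F) : (forall N, 0 <= x N) -> geo x ->
  geo (fun N => (1 + x N) ^+ N - 1).
Proof.
move=> x0 /geo_natM gx; have [C C0 xC] := geo_bounded gx.
apply: geo_le (geoZ (expR_ge0 C) gx) => N.
have le1 : (1 + x N) ^+ N <= expR (N%:R * x N).
  rewrite expRM_natl lerXn2r ?nnegrE ?expR_ge0 ?addr_ge0 //.
  exact: expR_ge1Dx.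
have le2 : expR (N%:R * x N) <= expR C by rewrite ler_expR.
have := expR_ge1Dx (- (N%:R * x N)); rewrite expRN.
have e0 := expR_gt0 (N%:R * x N).
rewrite -(ler_pM2r e0) mulVf ?gt_eqF // => le3.
have y0 : 0 <= N%:R * x N by rewrite mulr_ge0.
by have := ler_wpM2l y0 le2; lra.
Qed.

End GeometricDecay.

(** * The sum over unimodular vectors *)

Section ConcentrationSum.
Variables (F : realType) (R : finComUnitRingType).

Definition conc (xi : R -> F) (s : seq R) : F :=
  \big[Order.max/0]_t avgs xi s (@mass0 F R) t.

Definition entries L (w : 'cV[R]_L) : seq R := [seq w i 0 | i <- enum 'I_L].

Definition unimodular L (w : 'cV[R]_L) : bool := [exists i, w i 0 \is a GRing.unit].

(** [L] is the number of columns and [N] the number of rows of a random matrix: the [N]-th power of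
    the largest atom bounds the probability that the matrix maps [w] to a given vector. *)
Definition conc_sum (xi : R -> F) L N : F :=
  \sum_(w : 'cV[R]_L | unimodular w) conc xi (entries w) ^+ N.

Lemma law_le_conc xi s t : avgs xi s (@mass0 F R) t <= conc xi s.
Proof. exact: le_bigmax. Qed.

Lemma conc_ge0 xi s : 0 <= conc xi s.
Proof. exact: bigmax_ge_id. Qed.

Lemma conc_le xi s b : 0 <= b -> (forall t, avgs xi s (@mass0 F R) t <= b) -> conc xi s <= b.
Proof. by move=> b0 H; apply/bigmax_leP; split. Qed.

Lemma conc_le1 xi s : is_distribution xi -> conc xi s <= 1.
Proof.
move=> xiP; apply: conc_le => // t; apply: avgs_le => // u.
by rewrite /mass0 lern1 leq_b1.
Qed.

(** Substituting [x = u y + b] shifts a form by a constant and multiplies it by the unit [u], which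
    permutes its atoms. *)
Lemma conc_affine xi (u b : R) s : u \is a GRing.unit ->
  conc xi s <= conc (fun y => xi (u * y + b)) s.
Proof.
move=> uU; apply: conc_le; first exact: conc_ge0.
suff H t : avgs xi s (@mass0 F R) t =
    avgs (fun y => xi (u * y + b)) s (@mass0 F R) (u^-1 * (t - b * \sum_(h <- s) h)).
  by move=> t; rewrite H law_le_conc.
elim: s t => [|h s IH] t.
  rewrite big_nil mulr0 subr0 /= /mass0; congr (_%:R); congr (nat_of_bool _).
  by apply/eqP/eqP => [->|/(canRL (mulVKr uU))->]; rewrite mulr0.
rewrite !avgs_cons /avg (reindex_inj (inj_comp (addIr b) (mulrI uU))) /=.
apply: eq_bigr => y _; rewrite IH big_cons; congr (_ * avgs _ _ _ _).
rewrite -[h * y](mulKr uU) -mulrBr; congr (_ * _); ring.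
Qed.

Lemma count_sum_mem (p : pred R) (s : seq R) :
  count p s = (\sum_(h | p h) count_mem h s)%N.
Proof.
elim: s => /= [|x s ->]; first by rewrite big1.
rewrite big_split /=; congr (_ + _)%N.
have [px|px] := boolP (p x).
  rewrite (bigD1 x) //= eqxx big1 ?addn0 // => y /andP[_ /negbTE].
  by rewrite eq_sym => ->.
by rewrite big1 // => y py; case: eqP => // xy; rewrite xy py in px.
Qed.

Lemma sum_prod_col L (a : R -> F) :
  \sum_(w : 'cV[R]_L) \prod_(i < L) a (w i 0) = (\sum_x a x) ^+ L.
Proof.
rewrite -[L in RHS]card_ord -prodr_const bigA_distr_bigA /=.
rewrite (reindex (fun f : {ffun 'I_L -> R} => \col_i f i)) /=.
  by apply: eq_bigr => f _; apply: eq_bigr => i _; rewrite mxE.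
exists (fun w : 'cV[R]_L => [ffun i => w i 0]) => [f _|w _].
  by apply/ffunP => i; rewrite ffunE mxE.
by apply/colP => i; rewrite mxE ffunE.
Qed.

(* Every symbol outside [P] occurs at most [m] times: compare with the weight
   [lam] to the number of such entries. *)
Lemma card_frequent_le L m (P : {set R}) (lam : F) : 0 < lam <= 1 ->
  #|[set w : 'cV[R]_L | frequent m (entries w) == P]|%:R * lam ^+ (#|R| * m) <=
  (#|P|%:R + lam * #|R|%:R) ^+ L.
Proof.
move=> /andP[lam0 lam1]; pose a (x : R) : F := if x \in P then 1 else lam.
have a0 x : 0 <= a x by rewrite /a; case: ifP => _ //; exact: ltW.
apply: (@le_trans _ _ (\sum_(w : 'cV[R]_L) \prod_(i < L) a (w i 0))).
  rewrite [leRHS](bigID (fun w : 'cV[R]_L => frequent m (entries w) == P)) /=.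
  apply: ler_wpDr; first by apply: sumr_ge0 => w _; apply: prodr_ge0.
  rewrite mulr_natl -sumr_const big_mkcond [leRHS]big_mkcond /=.
  apply: ler_sum => w _; rewrite inE; case: eqP => // wP.
  have -> : \prod_(i < L) a (w i 0) = lam ^+ (count (predC (mem P)) (entries w)).
    rewrite -(big_map (fun i => w i 0) xpredT a) /index_enum -enumT.
    rewrite /entries; elim: [seq _ | _ <- _] => [|x s IH]; first by rewrite big_nil.
    by rewrite big_cons IH /= /a; case: (x \in P); rewrite ?mul1r // -exprS.
  rewrite ler_wiXn2l ?(ltW lam0) // count_sum_mem.
  apply: (@leq_trans (\sum_(h : R | predC (mem P) h) m)%N).
    apply: leq_sum => h; rewrite /= -wP inE -ltnNge; exact: ltnW.
  by rewrite sum_nat_const leq_mul2r max_card orbT.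
rewrite sum_prod_col lerXn2r ?nnegrE ?addr_ge0 ?sumr_ge0 ?mulr_ge0 ?ler0n ?(ltW lam0) //.
rewrite (bigID (mem P)) /= lerD //.
  rewrite (eq_bigr (fun=> 1)) ?sumr_const ?lexx // => x; rewrite /a.
  by move=> ->.
rewrite (eq_bigr (fun=> lam)); last by move=> x /negbTE; rewrite /a => ->.
by rewrite sumr_const -[leLHS]mulr_natr ler_wpM2l ?(ltW lam0) // ler_nat max_card.
Qed.

Lemma card_cV L : #|{: 'cV[R]_L}| = (#|R| ^ L)%N.
Proof. by rewrite card_mx muln1. Qed.

Section Normalized.
Variable xi : R -> F.
Hypothesis xi_distr : is_distribution xi.
Hypothesis xi0 : 0 < xi 0.
Hypothesis xi1 : 0 < xi 1.
Hypothesis xi_gen : forall S : {set R}, subring_closed S ->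
  support_of xi \subset S -> S = [set: R].

(** The vectors are sorted by their set of frequent entries. Where it spans [R], the largest atom is
    nearly [1 / q], and there are at most [q ^ L] such vectors; every other class has too few
    vectors for its atoms to give more than [r2 ^ L]. *)
Lemma conc_sum_bound_normalized : exists e : nat -> F, [/\ geo e, forall N, 0 <= e N &
  forall L N, (L <= N)%N -> (N <= 2 * L)%N ->
    conc_sum xi L N <= #|R|%:R ^+ L / #|R|%:R ^+ N * (1 + e N) + e N].
Proof.
have [n [gam [theta [/andP[gam0 gam1] /andP[th0 th1] HP]]]] :=
  concentration_bound xi_distr xi0 xi1 xi_gen.
pose q : F := #|R|%:R; pose th := (1 + theta) / 2; pose kap := (1 - th) / 4.
pose lam := kap / q.
(* [(1 + kap) ^+ 2 * th < 1]: one factor [1 + kap] pays for the choice of the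
   infrequent entries, the other for the bound [#|P| + lam * q] on a frequent one. *)
have q1 : 1 <= q by rewrite ler1n; apply/card_gt0P; exists 0.
have q0 : 0 < q by lra.
have th01 : 0 < th < 1 by rewrite /th; apply/andP; split; lra.
have [thp thl] := andP th01.
have kap01 : 0 < kap <= 4^-1 by rewrite /kap; apply/andP; split; lra.
have [kap0 kap1] := andP kap01.
have kap1_gt1 : 1 < 1 + kap by rewrite ltrDl.
have kap1_gt0 : 0 < 1 + kap := lt_trans ltr01 kap1_gt1.
have ikap_ge0 : 0 <= (1 + kap)^-1 by rewrite invr_ge0 ltW.
have ikap_lt1 : (1 + kap)^-1 < 1 by rewrite invf_lt1.
have lamq : lam * q = kap by rewrite /lam divfK // gt_eqF.
have lam0 : 0 < lam by rewrite divr_gt0.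
have lam1 : lam <= 1 by rewrite ler_pdivrMr //; lra.
(* Counting the vectors with a given frequent set costs a factor [lam ^ (#|R| * m)], with
   [m = n * l N]; [b1] makes it at least [(1 + kap) ^- (b1 * l N)]. *)
have [b1 b1P] : exists b1, ((1 + kap)^-1) ^+ b1 <= lam ^+ (#|R| * n).
  have k01 : 0 <= (1 + kap)^-1 < 1 by rewrite ikap_ge0.
  have [N0 N0P] := geo_small (geo_divn k01 (isT : (0 < 1)%N)) (exprn_gt0 (#|R| * n) lam0).
  by exists N0; have := N0P N0 (leqnn _); rewrite divn1.
(* The factor 2 gives [b1 * l N <= L], because [N <= 2 * L]; the successor keeps [b2] positive. *)
pose b2 := (2 * b1.+1)%N; pose l N := (N %/ b2)%N.
have b2_gt0 : (0 < b2)%N by [].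
pose g N := q * gam ^+ l N.
have g_geo : geo g by apply: geoZ; [exact: ltW | apply: geo_divn; rewrite ?gam0].
have g_ge0 N : 0 <= g N by rewrite mulr_ge0 ?exprn_ge0 // ltW.
(* From [N0] on, the additive error [gam ^ l] is absorbed by passing from [theta / h] to
   [th / h]. *)
have [N0 N0P] : exists N0, forall N, (N0 <= N)%N -> g N <= (1 - theta) / 2.
  by apply: geo_small => //; lra.
pose r2 := (1 + kap) ^+ 2 * th.
have r2_ge0 : 0 <= r2 by rewrite mulr_ge0 ?exprn_ge0 //; lra.
have r2_lt1 : r2 < 1.
  have -> : r2 = 1 - 2 * kap - 7 * (kap * kap) - 4 * (kap * (kap * kap)).
    by rewrite /r2 (_ : th = 1 - 4 * kap); [ring | rewrite /kap; field].
  have k2 : 0 < kap * kap by rewrite mulr_gt0.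
  have k3 : 0 < kap * (kap * kap) by rewrite mulr_gt0.
  lra.
(* [e1] comes from the vectors whose frequent entries span [R], [e2] from the others, summed over
   all possible frequent sets, and [e3] is the trivial bound for [N < N0]. *)
pose e1 N := (1 + g N) ^+ N - 1.
pose e2 N := #|{set R}|%:R * r2 ^+ (N %/ 2).
pose e3 N := q ^+ N0 * (N < N0)%N%:R.
have e1_ge0 N : 0 <= e1 N by rewrite subr_ge0 exprn_ege1 // lerDl.
have e2_ge0 N : 0 <= e2 N by rewrite mulr_ge0 ?exprn_ge0.
have e3_ge0 N : 0 <= e3 N by rewrite mulr_ge0 ?exprn_ge0 // ltW.
exists (fun N => e1 N + e2 N + e3 N); split.
- apply: geoD; [apply: geoD|].
  + exact: geo_exp1D.
  + by apply: geoZ => //; apply: geo_divn; rewrite ?r2_ge0.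
  + by apply: geo_finite; rewrite exprn_ge0 // ltW.
- by move=> N; rewrite addr_ge0 // addr_ge0.
move=> L N LN NL.
have qLN0 : 0 <= q ^+ L / q ^+ N by rewrite divr_ge0 ?exprn_ge0 ?(ltW q0).
rewrite -/q; set E := e1 N + e2 N + e3 N.
have /andP[eE1 /andP[eE2 eE3]] : [&& e1 N <= E, e2 N <= E & e3 N <= E].
  by apply/and3P; split; rewrite /E; [rewrite -addrA lerDl addr_ge0
    | rewrite addrAC lerDr addr_ge0 | rewrite lerDr addr_ge0].
have E_ge0 : 0 <= E := le_trans (e1_ge0 N) eE1.
have [NN0|NN0] := ltnP N N0.
  apply: (@le_trans _ _ (e3 N)); last first.
    by rewrite -[leLHS]add0r lerD // mulr_ge0 // addr_ge0.
  rewrite /e3 NN0 mulr1; apply: (@le_trans _ _ (\sum_(w : 'cV[R]_L) 1)).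
    rewrite /conc_sum big_mkcond /= ler_sum // => w _; case: ifP => // _.
    by rewrite exprn_ile1 ?conc_ge0 ?conc_le1.
  rewrite sumr_const card_cV natrX ler_weXn2l //.
  exact: leq_trans LN (ltnW NN0).
pose m := (n * l N)%N; pose G := gam ^+ l N.
have G0 : 0 <= G by rewrite exprn_ge0.
pose fr (w : 'cV[R]_L) := frequent m (entries w).
pose h (P : {set R}) : F := #|addspan P|%:R.
have h1 P : 1 <= h P.
  by rewrite ler1n; apply/card_gt0P; exists 0; case: (addspan_zmod_closed P).
have h0 P : 0 < h P := lt_le_trans ltr01 (h1 P).
have thh_ge0 P : 0 <= th / h P by rewrite divr_ge0 ?(ltW thp) // ltW.
have hq P : h P <= q by rewrite ler_nat max_card.
have Pcount P : #|[set w : 'cV[R]_L | fr w == P]|%:R * (th / h P) ^+ L <= r2 ^+ L.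
  have lam01 : 0 < lam <= 1 by rewrite lam0.
  have lamm0 : 0 < lam ^+ (#|R| * m) by rewrite exprn_gt0.
  have lamA : ((1 + kap)^-1) ^+ L <= lam ^+ (#|R| * m).
    apply: (@le_trans _ _ (((1 + kap)^-1 ^+ b1) ^+ l N)).
      rewrite -exprM; apply: ler_wiXn2l => //; first exact: ltW.
      apply: (@leq_trans (b1.+1 * l N)); first by rewrite leq_mul2r leqnSn orbT.
      have := leq_trans (leq_trunc_div N b2) NL; rewrite -/(l N).
      by move: (l N) => x; rewrite /b2 mulnCA leq_pmul2l // mulnC.
    rewrite /m mulnA exprM; apply: lerXn2r => //; rewrite nnegrE exprn_ge0 //.
    exact: ltW.
  have := card_frequent_le L m P lam01; rewrite lamq -/(fr _) => cP.
  have {cP} : #|[set w : 'cV[R]_L | fr w == P]|%:R * ((1 + kap)^-1) ^+ L <=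
    (h P * (1 + kap)) ^+ L.
    apply: le_trans (le_trans cP _); first by rewrite ler_wpM2l.
    apply: lerXn2r; rewrite ?nnegrE.
    - by rewrite addr_ge0 // ltW.
    - by rewrite mulr_ge0 // ltW.
    rewrite mulrDr mulr1 lerD ?ler_peMl ?(ltW kap0) //.
    by rewrite ler_nat subset_leq_card // sub_addspan.
  rewrite -ler_pdivlMr ?exprn_gt0 ?invr_gt0 //.
  rewrite -exprVn invrK -exprMn => cP.
  apply: le_trans (ler_wpM2r _ cP) _; first by rewrite exprn_ge0.
  have hP := h0 P; rewrite -exprMn (_ : _ * _ = r2) // /r2 expr2; field.
  by rewrite gt_eqF.
have bound w : unimodular w -> conc xi (entries w) ^+ N <=
    (q^-1 + G) ^+ N + (th / h (fr w)) ^+ L.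
  move=> /existsP[i wi]; have [H1 H2] := HP (l N) (entries w).
  have [spanT|spanT] := eqVneq (addspan (fr w)) [set: R].
    rewrite -[leLHS]addr0 lerD ?exprn_ge0 //.
    rewrite lerXn2r ?nnegrE ?conc_ge0 ?addr_ge0 ?invr_ge0 ?(ltW q0) //.
    by apply: conc_le; [rewrite addr_ge0 ?invr_ge0 ?(ltW q0)|exact: H1].
  rewrite -[leLHS]add0r lerD ?exprn_ge0 ?addr_ge0 ?invr_ge0 ?(ltW q0) //.
  have thh1 : th / h (fr w) <= 1.
    by rewrite ler_pdivrMr // mul1r (le_trans (ltW thl)).
  apply: (@le_trans _ _ ((th / h (fr w)) ^+ N)); last by rewrite ler_wiXn2l.
  rewrite lerXn2r ?nnegrE ?conc_ge0 //; apply: conc_le => // t.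
  have wU : has (mem GRing.unit) (entries w).
    by apply/hasP; exists (w i 0) => //; apply/mapP; exists i; rewrite ?mem_enum.
  apply: le_trans (H2 spanT wU t) _; rewrite -/(h (fr w)) -/G.
  rewrite ler_pdivlMr // mulrDl divfK ?gt_eqF //.
  have gN := N0P N NN0; have Gh : G * h (fr w) <= g N.
    by rewrite /g -/G mulrC ler_wpM2r.
  rewrite (_ : th = theta + (1 - theta) / 2); last by rewrite /th; field.
  by rewrite lerD2l (le_trans Gh).
apply: (@le_trans _ _ (\sum_(w : 'cV[R]_L) ((q^-1 + G) ^+ N + (th / h (fr w)) ^+ L))).
  rewrite /conc_sum big_mkcond ler_sum //= => w _.
  case: ifP => [/bound //|_].
  have qG : 0 <= q^-1 + G by rewrite addr_ge0 ?invr_ge0 ?(ltW q0).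
  by rewrite addr_ge0 ?exprn_ge0.
rewrite big_split /= sumr_const card_cV.
have -> : (q^-1 + G) ^+ N *+ (#|R| ^ L) = q ^+ L / q ^+ N * (1 + e1 N).
  have -> : 1 + e1 N = (1 + g N) ^+ N by rewrite /e1 addrC subrK.
  rewrite -[LHS]mulr_natr natrX -/q mulrC -mulrA; congr (_ * _).
  rewrite -exprVn -exprMn; congr (_ ^+ _); rewrite mulrDr mulr1 /g -/G; congr (_ + _).
  by rewrite mulKf // gt_eqF.
have part : \sum_(w : 'cV[R]_L) (th / h (fr w)) ^+ L <= e2 N.
  rewrite (partition_big fr xpredT) //= /e2 mulr_natl -sumr_const ler_sum // => P _.
  apply: (@le_trans _ _ (r2 ^+ L)); last first.
    rewrite ler_wiXn2l // ?(ltW r2_lt1) //.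
    have := leq_trans (leq_trunc_div N 2) NL.
    by move: (N %/ 2)%N => x; rewrite mulnC leq_pmul2l.
  apply: le_trans (Pcount P); rewrite mulr_natl -sumr_const.
  rewrite le_eqVlt; apply/orP; left; apply/eqP.
  by apply: eq_big => [w|w /eqP -> //]; rewrite inE.
apply: lerD; last exact: le_trans part _.
by rewrite ler_wpM2l // lerD2l.
Qed.

End Normalized.
End ConcentrationSum.

(** * General supports, reduced to supports containing 0 and 1 *)

Section GenericDistributions.
Variables (F : realType) (R : finComUnitRingType).

Definition generic_distribution (xi : R -> F) : Prop :=
  [/\ is_distribution xi,
    exists x y : R, [/\ x \in support_of xi, y \in support_of xi & x - y \is a GRing.unit]
  & forall (S : {set R}) (u b : R), proper_subring S ->
      ~ (support_of xi \subset affine_translate u b S)].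

(** The main term is what [#|R| ^ L] forms with all atoms equal to [1 / #|R|] would give. The
    condition [N <= 2 * L] turns decay in [L] into decay in [N]. *)
Definition conc_sum_bounded (e : nat -> F) (xi : R -> F) : Prop :=
  forall L N, (L <= N)%N -> (N <= 2 * L)%N ->
    conc_sum xi L N <= #|R|%:R ^+ L / #|R|%:R ^+ N * (1 + e N) + e N.

Lemma conc_sum_bounded_le e e' xi : (forall N, e N <= e' N) ->
  conc_sum_bounded e xi -> conc_sum_bounded e' xi.
Proof.
move=> ee' eP L N LN NL; apply: le_trans (eP L N LN NL) _.
by rewrite lerD // ler_wpM2l ?divr_ge0 ?exprn_ge0 // lerD2l.
Qed.

(** The affine change of variable that sends 0 to [y] and 1 to [x] normalizes the law. A proper
    subring containing the new support would give an affine translate containing the old one. *)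
Lemma conc_sum_bound (xi : R -> F) : generic_distribution xi ->
  exists e : nat -> F, [/\ geo e, forall N, 0 <= e N & conc_sum_bounded e xi].
Proof.
move=> [[xi_ge0 xi_sum] [x [y [xs ys uU]]] xi_aff].
set u := x - y in uU; pose xi' z := xi (u * z + y).
have [e [eg e0 eP]] : exists e : nat -> F, [/\ geo e, forall N, 0 <= e N &
    conc_sum_bounded e xi'].
  apply: conc_sum_bound_normalized.
  - split=> [z|]; first exact: xi_ge0.
    by rewrite -xi_sum [RHS](reindex_inj (inj_comp (addIr y) (mulrI uU))).
  - by rewrite /xi' mulr0 add0r lt_def xi_ge0 andbT; rewrite inE in ys.
  - by rewrite /xi' mulr1 /u subrK lt_def xi_ge0 andbT; rewrite inE in xs.
  - move=> S S_ring /fintype.subsetP sS; apply/eqP/negPn/negP => ST.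
    apply: (xi_aff S u y); first by split.
    apply/fintype.subsetP => z; rewrite inE => zs.
    apply/imsetP; exists (u^-1 * (z - y)); last by rewrite mulVKr // subrK.
    by apply: sS; rewrite inE /xi' mulVKr // subrK.
exists e; split=> // L N LN NL; apply: le_trans (eP L N LN NL).
apply: ler_sum => w _; rewrite lerXn2r ?nnegrE ?conc_ge0 //.
exact: conc_affine.
Qed.

Lemma geo_sum (I : finType) (e : I -> nat -> F) : (forall i, geo (e i)) ->
  geo (fun N => \sum_i e i N).
Proof.
move=> eg; elim: (index_enum I) => [|i s IH].
  exists 0, (2^-1); split=> //; first by apply/andP; split; lra.
  by move=> N; rewrite big_nil mul0r.
by apply: geo_le (geoD (eg i) IH) => N; rewrite big_cons.
Qed.

Lemma conc_sum_bound_family (I : finType) (xi : I -> R -> F) :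
  (forall i, generic_distribution (xi i)) ->
  exists e : nat -> F, [/\ geo e, forall N, 0 <= e N & forall i, conc_sum_bounded e (xi i)].
Proof.
move=> xiP; have /choice[e eP] := fun i => conc_sum_bound (xiP i).
have e0 i N : 0 <= e i N by case: (eP i).
exists (fun N => \sum_i e i N); split.
- by apply: geo_sum => i; case: (eP i).
- by move=> N; apply: sumr_ge0.
- move=> i; have [_ _] := eP i; apply: conc_sum_bounded_le => N.
  by rewrite (bigD1 i) //= lerDl sumr_ge0.
Qed.

Lemma card_ring_gt0 : 0 < #|R|%:R :> F.
Proof. by rewrite ltr0n; apply/card_gt0P; exists 0. Qed.

(** Lets the same estimates serve for uniform matrices. The support is all of [R], while an affine
    translate of [S] has at most [#|S|] elements. *)
Lemma uniform_generic : generic_distribution (@uniform_distribution F R).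
Proof.
have q0 := card_ring_gt0.
have suppT x : x \in support_of (@uniform_distribution F R).
  by rewrite inE invr_neq0 // gt_eqF.
split.
- split=> [x|]; first by rewrite invr_ge0 ltW.
  by rewrite sumr_const -[LHS]mulr_natr mulVf // gt_eqF.
- by exists 1, 0; split=> //; rewrite subr0 unitr1.
- move=> S u b [_ ST] /subset_leq_card.
  rewrite (_ : support_of _ = [set: R]); last by apply/setP => x; rewrite suppT inE.
  apply/negP; rewrite -ltnNge (leq_ltn_trans (leq_imset_card _ _)) //.
  by apply: proper_card; rewrite properT.
Qed.

End GenericDistributions.

(** * Random matrices *)

Section MatrixLaws.
Variables (F : realType) (R : finComUnitRingType).
Local Notation q := (#|R|%:R : F).

Lemma sum_prod_mx m n (G : 'I_m -> 'I_n -> R -> F) :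
  \sum_(A : 'M[R]_(m, n)) \prod_i \prod_j G i j (A i j) = \prod_i \prod_j \sum_x G i j x.
Proof.
rewrite [RHS]pair_bigA /= bigA_distr_bigA /=.
rewrite (reindex (fun f : {ffun 'I_m * 'I_n -> R} => \matrix_(i, j) f (i, j))) /=.
  apply: eq_bigr => f _; rewrite [LHS]pair_bigA /=; apply: eq_bigr => -[i j] _.
  by rewrite mxE.
exists (fun A : 'M[R]_(m, n) => [ffun p => A p.1 p.2]) => [f _|A _].
  by apply/ffunP => -[i j]; rewrite ffunE mxE.
by apply/matrixP => i j; rewrite mxE ffunE.
Qed.

Lemma sum_prod_rows m n (G : 'I_m -> 'rV[R]_n -> F) :
  \sum_(A : 'M[R]_(m, n)) \prod_i G i (row i A) = \prod_i \sum_x G i x.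
Proof.
rewrite bigA_distr_bigA /=.
rewrite (reindex (fun f : {ffun 'I_m -> 'rV[R]_n} => \matrix_i f i)) /=.
  by apply: eq_bigr => f _; apply: eq_bigr => i _; rewrite rowK.
exists (fun A : 'M[R]_(m, n) => [ffun i => row i A]) => [f _|A _].
  by apply/ffunP => i; rewrite ffunE rowK.
by apply/row_matrixP => i; rewrite rowK ffunE.
Qed.

Lemma sum_row_mx m n1 n2 (f : 'M[R]_(m, n1 + n2) -> F) :
  \sum_A f A = \sum_X \sum_Y f (row_mx X Y).
Proof.
rewrite pair_bigA /= (reindex (fun p : 'M[R]_(m, n1) * 'M[R]_(m, n2) => row_mx p.1 p.2)) //.
exists (fun A => (lsubmx A, rsubmx A)) => [[X Y] _|A _] /=; last exact: hsubmxK.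
by rewrite row_mxKl row_mxKr.
Qed.

Variable xi : R -> F.

Definition mxlaw m n (A : 'M[R]_(m, n)) : F := \prod_i \prod_j xi (A i j).

Definition Emx m n (f : 'M[R]_(m, n) -> F) : F := \sum_A mxlaw A * f A.

Lemma mxlaw_row_mx m n1 n2 (X : 'M[R]_(m, n1)) (Y : 'M[R]_(m, n2)) :
  mxlaw (row_mx X Y) = mxlaw X * mxlaw Y.
Proof.
rewrite /mxlaw -big_split /=; apply: eq_bigr => i _; rewrite big_split_ord /=.
by congr (_ * _); apply: eq_bigr => j _; rewrite ?row_mxEl ?row_mxEr.
Qed.

Lemma Emx_row_mx m n1 n2 (f : 'M[R]_(m, n1 + n2) -> F) :
  Emx f = Emx (fun X => Emx (fun Y => f (row_mx X Y))).
Proof.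
rewrite /Emx sum_row_mx; apply: eq_bigr => X _; rewrite mulr_sumr.
by apply: eq_bigr => Y _; rewrite mxlaw_row_mx mulrA.
Qed.

Hypothesis xi_distr : is_distribution xi.
Let xi_ge0 x : 0 <= xi x. Proof. by case: xi_distr. Qed.
Let xi_sum : \sum_x xi x = 1. Proof. by case: xi_distr. Qed.

Lemma mxlaw_ge0 m n (A : 'M[R]_(m, n)) : 0 <= mxlaw A.
Proof. by apply: prodr_ge0 => i _; apply: prodr_ge0. Qed.

Lemma mxlaw_sum m n : \sum_(A : 'M[R]_(m, n)) mxlaw A = 1.
Proof.
rewrite (sum_prod_mx (fun _ _ => xi)).
by rewrite big1 // => i _; rewrite big1.
Qed.

Lemma Emx_le m n (f g : 'M[R]_(m, n) -> F) : (forall A, f A <= g A) -> Emx f <= Emx g.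
Proof. by move=> fg; apply: ler_sum => A _; rewrite ler_wpM2l ?mxlaw_ge0. Qed.

Lemma Emx_cst m n c : Emx (fun _ : 'M[R]_(m, n) => c) = c.
Proof. by rewrite /Emx -mulr_suml mxlaw_sum mul1r. Qed.

Lemma Emx_D m n (f g : 'M[R]_(m, n) -> F) : Emx (fun A => f A + g A) = Emx f + Emx g.
Proof. by rewrite /Emx -big_split; apply: eq_bigr => A _; rewrite mulrDr. Qed.

Lemma Emx_Z m n c (f : 'M[R]_(m, n) -> F) : Emx (fun A => c * f A) = c * Emx f.
Proof. by rewrite /Emx mulr_sumr; apply: eq_bigr => A _; rewrite mulrCA. Qed.

Lemma Emx_B m n (f g : 'M[R]_(m, n) -> F) : Emx (fun A => f A - g A) = Emx f - Emx g.
Proof. by rewrite /Emx -sumrB; apply: eq_bigr => A _; rewrite mulrBr. Qed.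

Lemma Emx_sum m n (I : finType) (P : pred I) (f : I -> 'M[R]_(m, n) -> F) :
  Emx (fun A => \sum_(i | P i) f i A) = \sum_(i | P i) Emx (f i).
Proof.
rewrite /Emx exchange_big; apply: eq_bigr => A _; by rewrite mulr_sumr.
Qed.

Lemma Emx_abs m n (f : 'M[R]_(m, n) -> F) : `|Emx f| <= Emx (fun A => `|f A|).
Proof.
apply: le_trans (ler_norm_sum _ _ _) _; apply: ler_sum => A _.
by rewrite normrM ger0_norm ?mxlaw_ge0.
Qed.

Lemma mxlaw_form n (w : 'cV[R]_n) t :
  Emx (fun x : 'rV[R]_n => ((x *m w) 0 0 == t)%:R) = avgs xi (entries w) (@mass0 F R) t.
Proof.
elim: n w t => [|n IH] w t.
  rewrite /entries enum_ord0 /= /Emx (eq_bigr (fun A : 'rV[R]_0 => mxlaw A * (0 == t)%:R)).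
    by rewrite -mulr_suml mxlaw_sum mul1r /mass0 eq_sym.
  by move=> A _; rewrite mxE big_ord0.
have -> : entries w = w 0 0 :: entries (dsubmx (w : 'cV_(1 + n))).
  rewrite /entries enum_ordSl /= -map_comp; congr (_ :: _).
  by apply: eq_map => i /=; rewrite mxE; congr (w _ _); apply: val_inj.
rewrite avgs_cons /avg (Emx_row_mx (n1 := 1)) {1}/Emx.
rewrite (reindex (fun x : R => x%:M : 'M[R]_1)) /=; last first.
  exists (fun A : 'M[R]_1 => A 0 0) => [x _|A _]; first by rewrite mxE.
  by rewrite -mx11_scalar.
apply: eq_bigr => x _; rewrite -IH /mxlaw !big_ord1 mxE mulr1n; congr (_ * _).
apply: eq_bigr => Y _; congr (_ * (_)%:R); congr (nat_of_bool _).
rewrite -[w in LHS](vsubmxK (w : 'cV_(1 + n))) (mul_row_col (n1 := 1)) mxE.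
rewrite [X in X + _](_ : _ = w 0 0 * x).
  by rewrite -(inj_eq (addIr (- (w 0 0 * x)))) addrAC subrr add0r.
rewrite mxE big_ord1 !mxE mulr1n mulrC; congr (w _ _ * _); exact: val_inj.
Qed.

(** The rows are independent, so the probability is a product of [m] atoms of the form with
    coefficients [w]. *)
Lemma mxlaw_mulmx m n (w : 'cV[R]_n) (v : 'cV[R]_m) :
  Emx (fun A : 'M[R]_(m, n) => (A *m w == v)%:R) <= conc xi (entries w) ^+ m.
Proof.
have -> : Emx (fun A : 'M[R]_(m, n) => (A *m w == v)%:R) =
   \prod_i avgs xi (entries w) (@mass0 F R) (v i 0).
  under [RHS]eq_bigr => i _ do rewrite -mxlaw_form /Emx.
  rewrite -sum_prod_rows; apply: eq_bigr => A _; rewrite big_split /=.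
  congr (_ * _).
    apply: eq_bigr => i _; rewrite /mxlaw big_ord1.
    by apply: eq_bigr => j _; rewrite mxE.
  rewrite -natr_prod; congr (_%:R).
  have rowE i : (row i A *m w) 0 0 = (A *m w) i 0 by rewrite -row_mul mxE.
  case: eqP => [<-|Av]; first by rewrite big1 // => i _; rewrite rowE eqxx.
  have /existsP[i iN] : [exists i, (A *m w) i 0 != v i 0].
    apply/existsP; apply: contrapT => /forallNP H; apply: Av.
    by apply/colP => i; apply/eqP/negPn/negP/H.
  by rewrite (bigD1 i) //= rowE (negbTE iN).
rewrite -[in leRHS](card_ord m) -prodr_const ler_prod // => i _.
by rewrite law_ge0 ?law_le_conc.
Qed.

End MatrixLaws.

(** * Probability that left invertibility fails *)

Section RankDefect.
Variables (F : realType) (R : finComUnitRingType).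
Local Notation q := (#|R|%:R : F).
Hypothesis nonunitD : forall x y : R, x \isn't a GRing.unit ->
  y \isn't a GRing.unit -> x + y \isn't a GRing.unit.

(** The order of the maximal ideal; [nu / q] is the reciprocal of the order of the residue field. *)
Definition nonunit_number : F := #|[set x : R | x \isn't a GRing.unit]|%:R.
Local Notation nu := nonunit_number.

Lemma nonunit_number_gt0 : 0 < nu.
Proof. by rewrite ltr0n; apply/card_gt0P; exists 0; rewrite inE unitr0. Qed.

Lemma nonunit_number_lt : nu < q.
Proof.
rewrite ltr_nat -cardsT proper_card // properT; apply/eqP => /setP/(_ 1).
by rewrite !inE unitr1.
Qed.

Lemma unimodularPn n (v : 'cV[R]_n) :
  reflect (forall i, v i 0 \isn't a GRing.unit) (~~ unimodular v).
Proof. by apply: (iffP existsPn). Qed.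

Lemma card_nonunimodular n : #|[pred v : 'cV[R]_n | ~~ unimodular v]|%:R = nu ^+ n.
Proof.
have -> : nu = \sum_(x : R) (x \isn't a GRing.unit)%:R.
  rewrite /nu -sum1_card natr_sum big_mkcond /=; apply: eq_bigr => x _.
  by rewrite inE; case: (x \is a GRing.unit).
rewrite -sum_prod_col -sum1_card natr_sum big_mkcond /=; apply: eq_bigr => v _.
rewrite inE -natr_prod; case: (boolP (unimodular v)) => [/existsP[i vi]|/unimodularPn vN].
  by rewrite (bigD1 i) //= vi.
by rewrite big1 // => i _; rewrite vN.
Qed.

Lemma unimodularD n (v w : 'cV[R]_n) : unimodular v -> ~~ unimodular w -> unimodular (v + w).
Proof.
move=> /existsP[i vi] /unimodularPn wN; apply/existsP; exists i; rewrite mxE.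
apply/negPn/negP => vwN; move: vi; rewrite -(addrK (w i 0) (v i 0)); apply/negP.
by apply: nonunitD => //; rewrite unitrN.
Qed.

Lemma nonunimodularD n (v w : 'cV[R]_n) :
  ~~ unimodular v -> ~~ unimodular w -> ~~ unimodular (v + w).
Proof.
move=> /unimodularPn vN /unimodularPn wN; apply/unimodularPn => i; rewrite mxE.
exact: nonunitD.
Qed.

Lemma nonunimodularM m n (A : 'M[R]_(m, n)) (v : 'cV[R]_n) :
  ~~ unimodular v -> ~~ unimodular (A *m v).
Proof. by move=> /unimodularPn vN; apply/unimodularPn; apply: nonunit_mulmx. Qed.

(** Stated through an invertible [G], and not through a one-sided inverse, because [orbit_transport]
    needs [G] itself. *)
Definition left_invertible L s (A : 'M[R]_(L + s, L)) : bool :=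
  [exists G : 'M[R]_(L + s), (G \in unitmx) && (G *m A == col_mx 1%:M 0)].

(** One unimodular vector with nonunimodular image yields [nu ^ L] of them, by adding arbitrary
    vectors with nonunit entries. *)
Lemma left_invertiblePn L s (A : 'M[R]_(L + s, L)) : ~~ left_invertible A ->
  nu ^+ L <= \sum_(w : 'cV[R]_L | unimodular w) (~~ unimodular (A *m w))%:R.
Proof.
move=> AN; case: (local_elimination nonunitD A) => [[G GU GA]|[w0 [w0U w0N]]].
  by case/negP: AN; apply/existsP; exists G; rewrite GU GA eqxx.
have {}w0U : unimodular w0 by apply/existsP.
have {}w0N : ~~ unimodular (A *m w0) by apply/unimodularPn.
rewrite -card_nonunimodular -sum1_card natr_sum [leRHS](reindex_inj (addrI w0)) /=.
rewrite big_mkcond [leRHS]big_mkcond /=; apply: ler_sum => d _; rewrite inE.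
case: ifP => [dN|_]; last by case: ifP.
by rewrite unimodularD // mulmxDr nonunimodularD // nonunimodularM.
Qed.

(** [P] is onto, with right inverse [Q], so all its fibers have the same size, and [nu ^ r] of its
    [q ^ r] values are nonunimodular. *)
Lemma card_surj_nonunimodular r N (P : 'M[R]_(r, N)) (Q : 'M[R]_(N, r)) :
  P *m Q = 1%:M ->
  #|[pred v : 'cV[R]_N | ~~ unimodular (P *m v)]|%:R = (nu / q) ^+ r * q ^+ N.
Proof.
move=> PQ; have q0 : q != 0 by rewrite gt_eqF // card_ring_gt0.
pose K : F := #|[pred v : 'cV[R]_N | P *m v == 0]|%:R.
have fiber y : #|[pred v : 'cV[R]_N | P *m v == y]|%:R = K.
  rewrite /K -!sum1_card; congr (_%:R).
  rewrite (reindex_inj (addIr (Q *m y))) /=; apply: eq_bigl => v.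
  by rewrite !inE mulmxDr mulmxA PQ mul1mx -[X in _ == X]add0r (inj_eq (addIr _)).
have KE (p : pred 'cV[R]_r) :
    #|[pred v : 'cV[R]_N | p (P *m v)]|%:R = #|[pred y | p y]|%:R * K.
  rewrite -sum1_card natr_sum.
  rewrite (partition_big (fun v => P *m v) p) //=.
  rewrite mulr_natl -sumr_const; apply: eq_bigr => y py.
  rewrite -(fiber y) -sum1_card natr_sum; apply: eq_bigl => v; rewrite !inE.
  by case: eqP => [->|]; rewrite ?andbF // py.
have := KE xpredT; rewrite !card_cV !natrX => qK.
have qr : q ^+ r != 0 by rewrite expf_neq0.
by rewrite (KE (fun y => ~~ unimodular y)) card_nonunimodular qK expr_div_n mulrA divfK.
Qed.

Variable xi : R -> F.
Hypothesis xi_distr : is_distribution xi.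

(** First moment method: a failure produces at least [nu ^ L] pairs of a unimodular [w] and
    [v = M w] with [P v] nonunimodular. There are [(nu / q) ^ (L + s) * q ^ N] candidates [v], each
    hit with probability at most [conc xi (entries w) ^ N]. *)
Lemma prob_not_left_invertible L s N (P : 'M[R]_(L + s, N)) (Q : 'M[R]_(N, L + s)) :
  P *m Q = 1%:M ->
  Emx xi (fun M : 'M[R]_(N, L) => (~~ left_invertible (P *m M))%:R) <=
  (nu / q) ^+ s * (q ^+ N / q ^+ L) * conc_sum xi L N.
Proof.
move=> PQ; have q0 : q != 0 by rewrite gt_eqF // card_ring_gt0.
have nuL : 0 < nu ^+ L by rewrite exprn_gt0 ?nonunit_number_gt0.
rewrite -(ler_pM2l nuL) -Emx_Z.
apply: (@le_trans _ _ (Emx xi (fun M : 'M[R]_(N, L) =>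
   \sum_(w : 'cV[R]_L | unimodular w)
     \sum_(v : 'cV[R]_N | ~~ unimodular (P *m v)) (M *m w == v)%:R))).
  apply: Emx_le => // M.
  have [_|/left_invertiblePn MN] := boolP (left_invertible _).
    by rewrite mulr0; apply: sumr_ge0 => w _; apply: sumr_ge0.
  rewrite mulr1 (le_trans MN) //; apply: ler_sum => w _.
  rewrite -mulmxA; case: (boolP (unimodular (P *m (M *m w)))) => /= H.
    exact: sumr_ge0.
  by rewrite (bigD1 (M *m w)) //= eqxx lerDl sumr_ge0.
rewrite Emx_sum /conc_sum !mulr_sumr; apply: ler_sum => w _; rewrite Emx_sum.
apply: (@le_trans _ _ (\sum_(v : 'cV[R]_N | ~~ unimodular (P *m v)) conc xi (entries w) ^+ N)).
  by apply: ler_sum => v _; apply: mxlaw_mulmx.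
rewrite sumr_const -[leLHS]mulr_natl (card_surj_nonunimodular PQ).
rewrite le_eqVlt; apply/orP; left; apply/eqP.
rewrite exprD !expr_div_n; move: (conc _ _ ^+ N) => c; field.
by rewrite !expf_neq0.
Qed.

End RankDefect.

Section UniformMatrices.
Variables (F : realType) (R : finComUnitRingType).
Local Notation uni := (@uniform_distribution F R).

Lemma mxlaw_uniform m n (A : 'M[R]_(m, n)) : mxlaw uni A = (#|R|%:R^-1 ^+ n) ^+ m.
Proof.
rewrite /mxlaw (eq_bigr (fun=> #|R|%:R^-1 ^+ n)) => [|i _].
  by rewrite prodr_const card_ord.
by rewrite prodr_const card_ord.
Qed.

Lemma Emx_uniform_bij m n (h : 'M[R]_(m, n) -> 'M[R]_(m, n)) (f : 'M[R]_(m, n) -> F) :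
  bijective h -> Emx uni (fun A => f (h A)) = Emx uni f.
Proof.
move=> h_bij; rewrite /Emx [RHS](reindex h) /=; last exact: onW_bij.
by apply: eq_bigr => A _; rewrite !mxlaw_uniform.
Qed.

Lemma mulmx_bij m n (U : 'M[R]_m) : U \in unitmx -> bijective (@mulmx R m m n U).
Proof.
move=> UU; exists (@mulmx R m m n (invmx U)) => A; first by rewrite mulKmx.
by rewrite mulKVmx.
Qed.

End UniformMatrices.

(** * Distance of a smeared column from uniform *)

Section Smearing.
Variables (F : realType) (R : finComUnitRingType).
Local Notation q := (#|R|%:R : F).
Local Notation uni := (@uniform_distribution F R).
Variable xi : R -> F.
Hypothesis xi_distr : is_distribution xi.
Let xi_ge0 x : 0 <= xi x. Proof. by case: xi_distr. Qed.
Let q_gt0 : 0 < q. Proof. exact: card_ring_gt0. Qed.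
Let qX_gt0 n : 0 < q ^+ n. Proof. exact: exprn_gt0. Qed.

(* The law of [y + W k] for [y] with independent entries of law [xi] and [k]
   uniform. *)
Definition smear N L (W : 'M[R]_(N, L)) (z : 'cV[R]_N) : F :=
  (q ^+ L)^-1 * \sum_(k : 'cV[R]_L) mxlaw xi (z - W *m k).

Definition smear_dist N L (W : 'M[R]_(N, L)) : F :=
  \sum_z `|smear W z - (q ^+ N)^-1|.

Lemma smear_shift N L (W : 'M[R]_(N, L)) z k : smear W (z + W *m k) = smear W z.
Proof.
rewrite /smear; congr (_ * _); rewrite (reindex_inj (addIr k)) /=.
by apply: eq_bigr => k' _; rewrite mulmxDr opprD addrACA subrr addr0.
Qed.

Lemma smear_mean N L (W : 'M[R]_(N, L)) (g : 'cV[R]_N -> F) :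
  (forall z k, g (z + W *m k) = g z) -> \sum_z smear W z * g z = Emx xi g.
Proof.
move=> gW; rewrite /smear.
under eq_bigr => z _ do rewrite -mulrA mulr_suml.
rewrite -mulr_sumr exchange_big /= (eq_bigr (fun=> Emx xi g)) => [|k _].
  by rewrite sumr_const card_cV -[Emx xi g *+ _]mulr_natl natrX mulKf // gt_eqF.
rewrite (reindex_inj (addIr (W *m k))) /=.
by apply: eq_bigr => z _; rewrite addrK gW.
Qed.

Lemma smear_sum N L (W : 'M[R]_(N, L)) : \sum_z smear W z = 1.
Proof.
have := @smear_mean N L W (fun=> 1) (fun _ _ => erefl).
by rewrite Emx_cst // => <-; apply: eq_bigr => z _; rewrite mulr1.
Qed.

(** The columns are replaced one at a time. Given the first column, induction replaces the others;
    the resulting function of the first column is invariant under [W], so its mean is not changed by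
    smearing, and the distance of [smear] from uniform bounds the last error. *)
Lemma columns_bound N L (W : 'M[R]_(N, L)) n (f : 'M[R]_(N, n) -> F) :
  (forall Y, 0 <= f Y <= 1) -> (forall Y K, f (Y + W *m K) = f Y) ->
  `|Emx xi f - Emx uni f| <= n%:R * smear_dist W.
Proof.
have uni_distr : is_distribution uni by case: (@uniform_generic F R).
elim: n f => [|n IH] f f01 fW.
  have fE : f = (fun=> f 0) by apply/funext => Y; rewrite (thinmx0 Y).
  by rewrite fE !Emx_cst // subrr normr0 mul0r.
pose g (y : 'cV[R]_N) := Emx uni (fun Y : 'M[R]_(N, n) => f (row_mx y Y)).
have g01 y : 0 <= g y <= 1.
  apply/andP; split; [rewrite -(Emx_cst uni_distr N n 0) | rewrite -(Emx_cst uni_distr N n 1)];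
    by apply: Emx_le => // Y; have /andP[] := f01 (row_mx y Y).
have fW_row (y : 'cV[R]_N) (k : 'cV[R]_L) (Y : 'M[R]_(N, n)) :
    f (row_mx (y + W *m k) Y) = f (row_mx y Y).
  have -> : row_mx (y + W *m k) Y = row_mx y Y + W *m row_mx k 0 :> 'M[R]_(N, 1 + n).
    by rewrite mul_mx_row mulmx0 add_row_mx addr0.
  exact: fW.
have gW y k : g (y + W *m k) = g y.
  by congr Emx; apply/funext => Y; rewrite fW_row.
rewrite (Emx_row_mx xi (n1 := 1)) (Emx_row_mx uni (n1 := 1)) -/g.
rewrite -(subrK (Emx xi g) (Emx xi _)) -addrA (le_trans (ler_normD _ _)) //.
rewrite -natr1 mulrDl mul1r lerD //.
  rewrite -Emx_B (le_trans (Emx_abs _ _)) //.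
  rewrite -(Emx_cst xi_distr N 1 (n%:R * _)); apply: Emx_le => // y.
  apply: IH => [Y|Y K]; first exact: f01.
  have -> : row_mx y (Y + W *m K) = row_mx y Y + W *m row_mx 0 K :> 'M[R]_(N, 1 + n).
    by rewrite mul_mx_row mulmx0 add_row_mx addr0.
  exact: fW.
rewrite -(smear_mean gW) /Emx -sumrB /smear_dist.
apply: le_trans (ler_norm_sum _ _ _) _; apply: ler_sum => z _.
rewrite mxlaw_uniform expr1 exprVn -mulrBl normrM ler_piMr //.
by have /andP[? ?] := g01 z; rewrite ger0_norm.
Qed.

(** Chi-square bound, with AM-GM in place of Cauchy-Schwarz:
    [2 |p - u| <= d u + (p - u) ^ 2 / (d u)], summed over all points, where [u = q ^ - N]. The
    parameter [d] stays free so that no square root is needed here. *)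
Lemma smear_dist_le N L (W : 'M[R]_(N, L)) (d : F) : 0 < d ->
  smear_dist W <= (d + (q ^+ N * \sum_z smear W z ^+ 2 - 1) / d) / 2.
Proof.
move=> d0; set u := (q ^+ N)^-1; have u0 : 0 < u by rewrite invr_gt0.
have uq : q ^+ N = u^-1 by rewrite invrK.
have amgm p : `|p - u| <= (d * u + (q ^+ N * p ^+ 2 - p *+ 2 + u) / d) / 2.
  have -> : (d * u + (q ^+ N * p ^+ 2 - p *+ 2 + u) / d) / 2 =
     `|p - u| + (d * u - `|p - u|) ^+ 2 / (2 * (d * u)).
    have : `|p - u| ^+ 2 = (p - u) ^+ 2 by rewrite real_normK ?num_real.
    move: (`|p - u|) => a; rewrite uq => aE.
    have -> : (d * u - a) ^+ 2 = d ^+ 2 * u ^+ 2 - 2 * d * u * a + (p - u) ^+ 2.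
      by rewrite -aE; ring.
    by field; rewrite !gt_eqF.
  by rewrite lerDl divr_ge0 ?sqr_ge0 // ltW // !mulr_gt0.
apply: (@le_trans _ _ (\sum_(z : 'cV[R]_N)
    (d * u + (q ^+ N * smear W z ^+ 2 - smear W z *+ 2 + u) / d) / 2)).
  exact: ler_sum.
have -> : \sum_(z : 'cV[R]_N)
      (d * u + (q ^+ N * smear W z ^+ 2 - smear W z *+ 2 + u) / d) / 2 =
    (d * \sum_(z : 'cV[R]_N) u +
      (q ^+ N * \sum_z smear W z ^+ 2 - (\sum_z smear W z) *+ 2 +
       \sum_(z : 'cV[R]_N) u) / d) / 2.
  rewrite -mulr_suml; congr (_ / _); rewrite big_split /= mulr_sumr; congr (_ + _).
  rewrite -mulr_suml; congr (_ / _); rewrite big_split sumrB /= -sumrMnl.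
  by rewrite mulr_sumr.
have -> : \sum_(z : 'cV[R]_N) u = 1.
  by rewrite sumr_const card_cV -[u *+ _]mulr_natl natrX mulfV ?gt_eqF.
rewrite smear_sum mulr1 (_ : _ - 1 *+ 2 + 1 = q ^+ N * \sum_z smear W z ^+ 2 - 1) //.
by ring.
Qed.

(** Over a local ring, the probability that two independent variables of law [xi] agree modulo the
    maximal ideal. *)
Definition collision_mass : F :=
  \sum_x \sum_y xi x * xi y * (x - y \isn't a GRing.unit)%:R.

Lemma collision_massX N :
  \sum_(y : 'cV[R]_N) \sum_(z : 'cV[R]_N)
    mxlaw xi y * mxlaw xi z * (~~ unimodular (y - z))%:R = collision_mass ^+ N.
Proof.
rewrite /collision_mass -sum_prod_col; apply: eq_bigr => y _.
transitivity (\sum_(z : 'cV[R]_N) \prod_(i < N) \prod_(j < 1)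
   (xi (y i 0) * xi (z i j) * (y i 0 - z i j \isn't a GRing.unit)%:R)).
  apply: eq_bigr => z _; rewrite /mxlaw -!big_split /=.
  have -> : (~~ unimodular (y - z))%:R =
      \prod_(i < N) (y i 0 - z i 0 \isn't a GRing.unit)%:R :> F.
    rewrite -natr_prod; case: (boolP (unimodular _)) => [/existsP[i]|/unimodularPn vN].
      by rewrite !mxE => yz; rewrite (bigD1 i) //= yz.
    by rewrite big1 // => i _; have := vN i; rewrite !mxE => ->.
  by rewrite -big_split /=; apply: eq_bigr => i _; rewrite !big_ord1.
rewrite (sum_prod_mx (fun i (j : 'I_1) x =>
  xi (y i 0) * xi x * (y i 0 - x \isn't a GRing.unit)%:R)).
by apply: eq_bigr => i _; rewrite big_ord1.
Qed.

Hypothesis nonunitD : forall x y : R, x \isn't a GRing.unit ->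
  y \isn't a GRing.unit -> x + y \isn't a GRing.unit.

(** One factor [smear W] is itself invariant under the columns of [W], so the other one may be
    replaced by the unsmeared law. *)
Lemma smear_sq N L (W : 'M[R]_(N, L)) :
  q ^+ L * \sum_z smear W z ^+ 2 =
  \sum_(y : 'cV[R]_N) \sum_(k : 'cV[R]_L) mxlaw xi y * mxlaw xi (y - W *m k).
Proof.
rewrite (eq_bigr (fun z => smear W z * smear W z)) => [|z _]; last by rewrite expr2.
rewrite (smear_mean (smear_shift W)) /Emx mulr_sumr; apply: eq_bigr => y _.
by rewrite /smear mulrCA mulVKf ?gt_eqF // mulr_sumr.
Qed.

(** The terms are grouped by [d = W k]. A unimodular [d] comes only from unimodular [k], which in
    the mean contribute at most [conc_sum]. For nonunimodular [d] injectivity leaves at most one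
    [k], and [y] and [y - d] agree modulo the maximal ideal. *)
Lemma Emx_smear_sq N L (good : pred 'M[R]_(N, L)) :
  (forall W, good W -> injective (mulmx W : 'cV[R]_L -> 'cV[R]_N)) ->
  Emx xi (fun W => (good W)%:R * (q ^+ L * \sum_z smear W z ^+ 2)) <=
  conc_sum xi L N + collision_mass ^+ N.
Proof.
move=> good_inj; pose S := conc_sum xi L N.
pose cnt (W : 'M[R]_(N, L)) (d : 'cV[R]_N) : F :=
  if unimodular d then \sum_(k : 'cV[R]_L | unimodular k) (W *m k == d)%:R else 1.
have cntP W d : good W -> \sum_(k : 'cV[R]_L) (W *m k == d)%:R <= cnt W d.
  move=> /good_inj Winj; rewrite /cnt; case: ifPn => dU.
    rewrite (bigID (@unimodular _ _)) /= gerDl big1 // => k kN.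
    by case: eqP => // Wkd; move: dU; rewrite -Wkd (negbTE (nonunimodularM _ _ kN)).
  have [/existsP[k0 /eqP k0d]|/existsPn none] := boolP [exists k, W *m k == d].
    rewrite (bigD1 k0) //= k0d eqxx big1 ?addr0 // => k kk0.
    by case: eqP => // kd; move: kk0; rewrite (Winj k k0) ?eqxx ?kd.
  by rewrite big1 // => k _; rewrite (negbTE (none k)).
have S0 : 0 <= S by apply: sumr_ge0 => w _; rewrite exprn_ge0 ?conc_ge0.
apply: (@le_trans _ _ (Emx xi (fun W => \sum_(y : 'cV[R]_N) \sum_(d : 'cV[R]_N)
    (mxlaw xi y * mxlaw xi (y - d)) * cnt W d))).
  apply: Emx_le => // W; have [Wg|_] := boolP (good W); last first.
    rewrite mul0r; apply: sumr_ge0 => y _; apply: sumr_ge0 => d _.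
    rewrite !mulr_ge0 ?mxlaw_ge0 // /cnt; case: ifP => // _; exact: sumr_ge0.
  rewrite mul1r smear_sq; apply: ler_sum => y _.
  rewrite (partition_big (fun k => W *m k) xpredT) //=; apply: ler_sum => d _.
  apply: (@le_trans _ _ (mxlaw xi y * mxlaw xi (y - d) * \sum_k (W *m k == d)%:R)).
    rewrite mulr_sumr big_mkcond /=; apply: ler_sum => k _.
    by case: eqP => [->|_]; rewrite ?mulr1 ?mulr0.
  by rewrite ler_wpM2l ?cntP // mulr_ge0 ?mxlaw_ge0.
rewrite Emx_sum.
have cntE d : Emx xi (fun W : 'M[R]_(N, L) => cnt W d) <= S + (~~ unimodular d)%:R.
  rewrite /cnt; case: (boolP (unimodular d)) => dU /=; last by rewrite Emx_cst // lerDr S0.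
  by rewrite addr0 Emx_sum; apply: ler_sum => k _; apply: mxlaw_mulmx.
apply: (@le_trans _ _ (\sum_(y : 'cV[R]_N) \sum_(d : 'cV[R]_N)
    (mxlaw xi y * mxlaw xi (y - d)) * (S + (~~ unimodular d)%:R))).
  apply: ler_sum => y _; rewrite Emx_sum; apply: ler_sum => d _.
  by rewrite Emx_Z ler_wpM2l ?cntE // mulr_ge0 ?mxlaw_ge0.
have shift (h : 'cV[R]_N -> F) y : \sum_(d : 'cV[R]_N)
    (mxlaw xi y * mxlaw xi (y - d)) * h d =
    \sum_(z : 'cV[R]_N) mxlaw xi y * mxlaw xi z * h (y - z).
  rewrite (reindex_inj (inj_comp (addrI y) oppr_inj)) /=.
  by apply: eq_bigr => z _; rewrite opprD addrA subrr opprK add0r.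
under eq_bigr => y _ do rewrite shift.
under eq_bigr => y _ do under eq_bigr => z _ do rewrite mulrDr.
under eq_bigr => y _ do rewrite big_split /=.
rewrite big_split /= collision_massX lerD2r.
under eq_bigr => y _ do rewrite -mulr_suml -mulr_sumr mxlaw_sum // mulr1.
by rewrite -mulr_suml mxlaw_sum // mul1r.
Qed.

Lemma collision_mass_ge0 : 0 <= collision_mass.
Proof. by apply: sumr_ge0 => x _; apply: sumr_ge0 => y _; rewrite !mulr_ge0. Qed.

Lemma collision_mass_lt1 :
  (exists x y : R, [/\ x \in support_of xi, y \in support_of xi & x - y \is a GRing.unit]) ->
  collision_mass < 1.
Proof.
move=> [x [y [xs ys xyU]]]; have xi_sum : \sum_x xi x = 1 by case: xi_distr.
have -> : (1 : F) = \sum_x \sum_y xi x * xi y.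
  by rewrite -[LHS]mulr1 -{1}xi_sum -xi_sum mulr_suml; apply: eq_bigr => z _; rewrite mulr_sumr.
rewrite /collision_mass (bigD1 x) //= [ltRHS](bigD1 x) //=.
have le_all z w : xi z * xi w * (z - w \isn't a GRing.unit)%:R <= xi z * xi w.
  by rewrite ler_piMr ?mulr_ge0 // lern1 leq_b1.
apply: ltr_leD; last by apply: ler_sum => z _; apply: ler_sum.
rewrite (bigD1 y) //= [ltRHS](bigD1 y) //= xyU mulr0 ltr_leD ?ler_sum //.
by rewrite inE in xs; rewrite inE in ys; rewrite lt_def mulr_ge0 // mulf_neq0.
Qed.

End Smearing.

(** * One factor *)

Section OneStep.
Variables (F : realType) (R : finComUnitRingType).
Local Notation q := (#|R|%:R : F).
Local Notation uni := (@uniform_distribution F R).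
Hypothesis nonunitD : forall x y : R, x \isn't a GRing.unit ->
  y \isn't a GRing.unit -> x + y \isn't a GRing.unit.
Variable xi : R -> F.
Hypothesis xi_distr : is_distribution xi.

Let uni_distr : is_distribution uni.
Proof. by case: (@uniform_generic F R). Qed.

Lemma Emx_01 (x : R -> F) m n (f : 'M[R]_(m, n) -> F) : is_distribution x ->
  (forall X, 0 <= f X <= 1) -> 0 <= Emx x f <= 1.
Proof.
move=> xP f01; rewrite -(Emx_cst xP m n 0) -(Emx_cst xP m n 1).
by apply/andP; split; apply: Emx_le => // X; have /andP[] := f01 X.
Qed.

Lemma dist01_le1 (a b : F) : 0 <= a <= 1 -> 0 <= b <= 1 -> `|a - b| <= 1.
Proof. by move=> /andP[? ?] /andP[? ?]; rewrite ler_norml; apply/andP; split; lra. Qed.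

(* Bounds the probability that [P A M] is not left invertible. *)
Definition defect (L s N : nat) : F :=
  (nonunit_number F R / q) ^+ s * (q ^+ N / q ^+ L) * conc_sum xi L N.

(* [d] is the AM-GM parameter of [smear_dist_le]. *)
Definition step_error (L s N n : nat) (d : F) : F :=
  defect L s N + n%:R * ((d + (q ^+ N / q ^+ L * (conc_sum xi L N + collision_mass xi ^+ N)
     - (1 - defect L s N)) / d) / 2).

(** When [P A M] is left invertible, column shears make the mean over [Y] nearly uniform, and
    [orbit_transport] then moves [M] to the fixed matrix [Q [1; 0]], the uniform block absorbing
    [U]. Otherwise the trivial bound 1 is used. The reference value does not depend on [xi]. *)
Lemma universality_step (L s N n : nat) (A : 'M[R]_N) (P : 'M[R]_(L + s, N))
    (Q : 'M[R]_(N, L + s)) (phi : 'M[R]_(N, L + n) -> F) (d : F) :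
  0 < d -> P *m A *m Q = 1%:M -> (forall X, 0 <= phi X <= 1) ->
  (forall X V, V \in unitmx -> phi (X *m V) = phi X) ->
  (forall X U V, U \in unitmx -> V \in unitmx -> A *m U = V *m A ->
     phi (U *m X) = phi X) ->
  `|Emx xi phi - Emx uni (fun Z => phi (row_mx (Q *m col_mx 1%:M 0) Z))| <=
  step_error L s N n d.
Proof.
move=> d0 PAQ phi01 phi_r phi_l; set c := Emx uni _.
have q0 : 0 < q := card_ring_gt0 F R.
pose good (M : 'M[R]_(N, L)) := left_invertible (P *m A *m M).
have good_inj M : good M -> injective (mulmx M : 'cV[R]_L -> 'cV[R]_N).
  move=> /existsP[G /andP[_ /eqP GM]] v w /(congr1 (mulmx (row_mx 1%:M 0 *m G *m P *m A))).
  rewrite !mulmxA -!(mulmxA (row_mx _ _)) -!(mulmxA G) !mulmxA.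
  have -> : row_mx 1%:M 0 *m G *m P *m A *m M = 1%:M :> 'M[R]_L.
    by rewrite -!mulmxA !(mulmxA P) GM mul_row_col mulmx1 mul0mx addr0.
  by rewrite !mul1mx.
have c01 : 0 <= c <= 1 by apply: Emx_01.
have phi_shear (M : 'M[R]_(N, L)) Y K : phi (row_mx M (Y + M *m K)) = phi (row_mx M Y).
  pose V : 'M[R]_(L + n) := block_mx 1%:M K 0 1%:M.
  have VU : V \in unitmx by rewrite unitmxE det_ublock !det1 mulr1 unitr1.
  rewrite -(phi_r (row_mx M Y) V VU) /V mul_row_block.
  by rewrite !mulmx1 mulmx0 addr0 addrC.
have goodE M : good M -> Emx uni (fun Z => phi (row_mx M Z)) = c.
  move=> /existsP[G /andP[GU /eqP GM]].
  have [U [V [UU VU AU UM]]] := orbit_transport PAQ GU GM.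
  rewrite /c -[RHS](Emx_uniform_bij _ (mulmx_bij _ UU)) /=.
  by congr Emx; apply/funext => Z; rewrite -(phi_l _ _ _ UU VU AU) mul_mx_row UM.
(* One formula covers both cases and is affine in the indicators and in the good part of the second
   moment, so its mean is computed term by term. *)
pose err M := (~~ good M)%:R + n%:R * ((d + (q ^+ N / q ^+ L *
   ((good M)%:R * (q ^+ L * \sum_z smear xi M z ^+ 2)) - (1 - (~~ good M)%:R)) / d) / 2).
have pointwise M : `|Emx xi (fun Y => phi (row_mx M Y)) - c| <= err M.
  have [Mg|Mb] := boolP (good M); rewrite /err ?Mg ?(negbTE Mb) /=.
    rewrite add0r subr0 mul1r -(goodE M Mg).
    apply: le_trans (columns_bound xi_distr (W := M) _ _) _ => //.
    rewrite ler_wpM2l // (le_trans (smear_dist_le xi_distr M d0)) //.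
    by rewrite mulrA divfK // expf_neq0 // gt_eqF.
  have e01 : 0 <= Emx xi (fun Y => phi (row_mx M Y)) <= 1 by apply: Emx_01.
  rewrite (le_trans (dist01_le1 e01 c01)) // lerDl.
  rewrite mul0r mulr0 subrr subr0 mul0r addr0.
  by rewrite mulr_ge0 // divr_ge0 // ltW.
rewrite Emx_row_mx -[X in _ - X](Emx_cst xi_distr N L c) -Emx_B.
apply: le_trans (Emx_abs xi_distr _) _.
apply: le_trans (Emx_le xi_distr pointwise) _.
have := prob_not_left_invertible nonunitD xi_distr PAQ; rewrite -/(defect L s N).
set B := Emx xi _ => Ble.
have := Emx_smear_sq xi_distr nonunitD good_inj; set T := Emx xi _ => Tle.
have -> : Emx xi err = B + n%:R * ((d + (q ^+ N / q ^+ L * T - (1 - B)) / d) / 2).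
  rewrite /err Emx_D Emx_Z; congr (_ + _ * _).
  transitivity (Emx xi (fun M : 'M[R]_(N, L) => 2^-1 * (d + d^-1 * (q ^+ N / q ^+ L *
   ((good M)%:R * (q ^+ L * \sum_z smear xi M z ^+ 2)) - (1 - (~~ good M)%:R))))).
    by congr Emx; apply/funext => M; rewrite mulrC (mulrC d^-1).
  rewrite Emx_Z Emx_D Emx_cst // Emx_Z Emx_B Emx_Z Emx_B Emx_cst //.
  by rewrite mulrC (mulrC d^-1).
rewrite /step_error; apply: lerD => //; rewrite ler_wpM2l // ler_pM2r ?invr_gt0 //.
rewrite lerD2l ler_pM2r ?invr_gt0 //; apply: lerB; last by rewrite lerD2l lerN2.
by rewrite ler_wpM2l // divr_ge0 ?exprn_ge0 // ltW.
Qed.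

End OneStep.

(** * Products of factors *)

Section CokernelInvariance.
Local Open Scope quotient_scope.
Variables (R : finComUnitRingType) (N : nat).

Local Notation pi A := (\pi_(Quotient.quot (colspan A)) : 'cV[R]_N -> coker A).

Lemma coker_eqP (A : 'M[R]_N) (v w : 'cV[R]_N) :
  reflect (pi A v = pi A w) (v - w \in colspan A).
Proof.
apply: (iffP idP) => [vw|/eqmodP]; last by rewrite /= Quotient.equivE.
by apply/eqmodP; rewrite /= Quotient.equivE.
Qed.

Lemma colspan_unit (A U V : 'M[R]_N) v : U \in unitmx -> V \in unitmx ->
  (U *m v \in colspan (U *m A *m V)) = (v \in colspan A).
Proof.
move=> UU VU; apply/existsP/existsP => -[w /eqP wE].
  exists (V *m w); rewrite mulmxA; apply/eqP/(can_inj (mulKmx UU)).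
  by rewrite wE !mulmxA.
by exists (invmx V *m w); rewrite wE -!mulmxA mulKVmx.
Qed.

(** Multiplication by [U] carries the column span of [A] onto that of [U A V], because [V] is
    invertible. *)
Lemma coker_isomorphic (A U V : 'M[R]_N) : U \in unitmx -> V \in unitmx ->
  isomorphic (coker A) (coker (U *m A *m V)).
Proof.
move=> UU VU; pose B := U *m A *m V.
pose f (x : coker A) : coker B := pi B (U *m generic_quotient.repr x).
pose g (y : coker B) : coker A := pi A (invmx U *m generic_quotient.repr y).
have fE v : f (pi A v) = pi B (U *m v).
  apply/coker_eqP; rewrite -mulmxBr colspan_unit //.
  by apply/coker_eqP; rewrite coker_reprK.
have gE v : g (pi B v) = pi A (invmx U *m v).
  apply/coker_eqP; rewrite -mulmxBr -(colspan_unit _ _ UU VU) mulKVmx //.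
  by apply/coker_eqP; rewrite coker_reprK.
have f_lin : linear f.
  move=> a x y; rewrite -[x]coker_reprK -[y]coker_reprK.
  rewrite -[a *: _]/(coker_scale a _) coker_piZ coker_piD !fE.
  by rewrite -[a *: _ in RHS]/(coker_scale a _) coker_piZ coker_piD mulmxDr -scalemxAr.
pose F : {linear coker A -> coker B} := HB.pack f (GRing.isLinear.Build _ _ _ _ f f_lin).
exists F, g => [x|y] /=.
  by rewrite -[x]coker_reprK fE gE mulKmx.
by rewrite -[y]coker_reprK gE fE mulKVmx.
Qed.

Lemma iso_class_coker (A U V : 'M[R]_N) : U \in unitmx -> V \in unitmx ->
  iso_class (coker (U *m A *m V)) = iso_class (coker A).
Proof. by move=> UU VU; apply/esym/iso_classP/coker_isomorphic. Qed.

End CokernelInvariance.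

(** * Replacement of the factors by uniform ones *)

Section ProductChain.
Variables (F : realType) (R : finComUnitRingType).
Local Notation q := (#|R|%:R : F).
Local Notation uni := (@uniform_distribution F R).
Hypothesis nonunitD : forall x y : R, x \isn't a GRing.unit ->
  y \isn't a GRing.unit -> x + y \isn't a GRing.unit.

Let uni_distr : is_distribution uni.
Proof. by case: (@uniform_generic F R). Qed.

(** The mean of [Psi] at [A X_1 X_2 ...] with independent factors of laws [ps]; [A] accumulates the
    factors already fixed. *)
Fixpoint prodE N (ps : seq (R -> F)) (Psi : 'M[R]_N -> F) (A : 'M[R]_N) : F :=
  if ps is p :: ps' then Emx p (fun X => prodE ps' Psi (A *m X)) else Psi A.

Definition equivalence_invariant N (Psi : 'M[R]_N -> F) : Prop :=
  forall A U V, U \in unitmx -> V \in unitmx -> Psi (U *m A *m V) = Psi A.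

(** The next uniform factor absorbs [V] on its left, and [U] passes through to [Psi]. *)
Lemma prodE_uniform_invariant N k (Psi : 'M[R]_N -> F) :
  equivalence_invariant Psi -> equivalence_invariant (prodE (nseq k uni) Psi).
Proof.
move=> Psi_inv; elim: k => //= k IH A U V UU VU.
rewrite -[RHS](Emx_uniform_bij _ (mulmx_bij _ VU)).
congr Emx; apply/funext => X.
rewrite -[RHS](IH _ U 1%:M UU (unitmx1 _ _)) mulmx1.
by rewrite !mulmxA.
Qed.

Lemma prodE_01 N ps (Psi : 'M[R]_N -> F) (A : 'M[R]_N) :
  {in ps, forall p, is_distribution p} -> (forall B, 0 <= Psi B <= 1) ->
  0 <= prodE ps Psi A <= 1.
Proof.
move=> psP Psi01; elim: ps psP A => //= p ps IH psP A.
apply: Emx_01 => [|X]; first by apply: psP; rewrite inE eqxx.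
by apply: IH => p' p'ps; apply: psP; rewrite inE p'ps orbT.
Qed.

(** Over a local ring this says that the reduction to the residue field has rank at least
    [N - t]. *)
Definition corank_le N t (A : 'M[R]_N) : Prop :=
  exists r (P : 'M[R]_(r, N)) (Q : 'M[R]_(N, r)), (r + t = N)%N /\ P *m A *m Q = 1%:M.

(** Each factor costs [3 * err]. The later factors are replaced first, which costs one [err] for the
    event that the corank of the product grows by more than [n]. Then the current factor and a
    uniform one are both compared with the same reference value, at one [err] each. *)
Lemma prodE_chain N n k (err d : F) (Psi : 'M[R]_N -> F) ps j (A : 'M[R]_N) :
  0 < d -> equivalence_invariant Psi -> (forall B, 0 <= Psi B <= 1) ->
  (k * n <= N)%N -> (size ps + j <= k)%N -> {in ps, forall p, is_distribution p} ->
  (forall p i, p \in uni :: ps -> (i < k)%N ->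
     step_error p (N - i.+1 * n) n N (i.+1 * n) d <= err /\
     defect p (N - i.+1 * n) n N <= err) ->
  corank_le (j * n) A ->
  `|prodE ps Psi A - prodE (nseq (size ps) uni) Psi A| <= (size ps)%:R * (3 * err).
Proof.
move=> d0 Psi_inv Psi01 knN; elim: ps j A => [|p ps IH] j A jk psP errP.
  by rewrite /= subrr normr0 mul0r.
case=> r [P [Q [rN PAQ]]].
have pP : is_distribution p by apply: psP; rewrite inE eqxx.
have psP' : {in ps, forall p, is_distribution p}.
  by move=> p' p'ps; apply: psP; rewrite inE p'ps orbT.
have jk' : (j < k)%N by move: jk => /=; lia.
have jn : (j.+1 * n <= N)%N by apply: leq_trans knN; rewrite leq_mul2r jk' orbT.
have [L LE] : exists L, L = (N - j.+1 * n)%N by exists (N - j.+1 * n)%N.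
(* Of the [L + n] rows of [P], [n] are kept as slack, so that a product with [L] random columns is
   left invertible with high probability. *)
have rE : r = (L + n)%N by rewrite LE; move: jn rN; rewrite mulSn; lia.
have NE : N = (L + j.+1 * n)%N by rewrite LE subnK.
subst r; move: (errP p j) (errP uni j).
rewrite -LE !inE !eqxx orbT => /(_ isT jk')[p_step p_def] /(_ isT jk')[u_step _].
have errP' p' i : p' \in uni :: ps -> (i < k)%N ->
     step_error p' (N - i.+1 * n) n N (i.+1 * n) d <= err /\
     defect p' (N - i.+1 * n) n N <= err.
  by move=> p'in; apply: errP; move: p'in; rewrite !inE => /orP[->//|->]; rewrite !orbT.
have {}IH B : corank_le (j.+1 * n) B ->
  `|prodE ps Psi B - prodE (nseq (size ps) uni) Psi B| <= (size ps)%:R * (3 * err).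
  by apply: IH => //; move: jk => /=; lia.
(* Generalizing the width lets [N] be replaced by [L + n'], so that the columns split as
   [universality_step] requires. *)
move: (j.+1 * n)%N NE p_step u_step IH {errP errP' LE jn rN knN} => n' NE.
subst N => p_step u_step IH.
set unis := nseq (size ps) uni in IH *; pose phi X := prodE unis Psi (A *m X).
have unisP : {in unis, forall p, is_distribution p} by move=> p' /nseqP[->].
have phi01 X : 0 <= phi X <= 1 by apply: prodE_01.
have err0 : 0 <= err.
  apply: le_trans p_def; rewrite /defect !mulr_ge0 ?invr_ge0 ?exprn_ge0 //.
    by rewrite divr_ge0 // ltW ?nonunit_number_gt0.
  by apply: sumr_ge0 => w _; rewrite exprn_ge0 ?conc_ge0.
have inv := prodE_uniform_invariant (size ps) Psi_inv.
have phi_r X V : V \in unitmx -> phi (X *m V) = phi X.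
  by move=> VU; rewrite /phi -(inv (A *m X) 1%:M V) ?unitmx1 // mul1mx mulmxA.
have phi_l X U V : U \in unitmx -> V \in unitmx -> A *m U = V *m A -> phi (U *m X) = phi X.
  move=> UU VU AU; rewrite /phi -(inv (A *m X) V 1%:M) ?unitmx1 //.
  by rewrite mulmx1 !mulmxA AU.
have step_p := universality_step nonunitD pP d0 PAQ phi01 phi_r phi_l.
have step_u := universality_step nonunitD uni_distr d0 PAQ phi01 phi_r phi_l.
have swap : `|Emx p phi - Emx uni phi| <= 2 * err.
  rewrite -(subrK (Emx uni (fun Z => phi (row_mx (Q *m col_mx 1%:M 0) Z))) (Emx p phi)) -addrA.
  apply: le_trans (ler_normD _ _) _; rewrite [2 * err](_ : _ = err + err); last by ring.
  apply: lerD; first exact: le_trans step_p _.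
  by rewrite distrC; apply: le_trans step_u _.
pose bad (M : 'M[R]_(L + n', L + n')) : F := (~~ left_invertible (P *m A *m lsubmx M))%:R.
have bad_le : Emx p bad <= err.
  rewrite Emx_row_mx; apply: le_trans p_def.
  apply: le_trans (prob_not_left_invertible nonunitD pP PAQ).
  apply: Emx_le => // M.
  rewrite /bad (_ : (fun _ => _) = (fun=> (~~ left_invertible (P *m A *m M))%:R)).
    by rewrite Emx_cst.
  by apply/funext => Y; rewrite row_mxKl.
have tail : `|Emx p (fun X => prodE ps Psi (A *m X)) - Emx p phi| <=
    (size ps)%:R * (3 * err) + err.
  rewrite -Emx_B; apply: le_trans (Emx_abs pP _) _.
  apply: (@le_trans _ _ (Emx p (fun M => (size ps)%:R * (3 * err) + bad M))); last first.
    by rewrite Emx_D Emx_cst // lerD2l.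
  apply: Emx_le => // M; rewrite /bad.
  case: (boolP (left_invertible _)) => [/existsP[G /andP[_ /eqP GM]]|_].
    (* The first [L] columns of [M] supply the new right factor, and the first [L] rows of [G P] the
       new left factor. *)
    rewrite addr0; apply: IH; exists L, (row_mx 1%:M 0 *m G *m P), (col_mx 1%:M 0).
    have MC : M *m col_mx 1%:M 0 = lsubmx M.
      by rewrite -{1}[M]hsubmxK mul_row_col mulmx1 mulmx0 addr0.
    split=> //; rewrite -(mulmxA _ (A *m M)) -(mulmxA A M) MC -(mulmxA _ P) (mulmxA P A).
    by rewrite -(mulmxA _ G) GM mul_row_col mulmx1 mul0mx addr0.
  apply: (@le_trans _ _ 1); first by apply: dist01_le1; [apply: prodE_01 | exact: phi01].
  by rewrite lerDr !mulr_ge0.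
rewrite /= -/unis -/(phi) -(subrK (Emx p phi) (Emx p _)) -addrA.
apply: le_trans (ler_normD _ _) _.
have -> : (size ps).+1%:R * (3 * err) = ((size ps)%:R * (3 * err) + err) + 2 * err.
  by rewrite -natr1; ring.
exact: lerD.
Qed.

Lemma corank_le0 N : corank_le 0 (1%:M : 'M[R]_N).
Proof. by exists N, 1%:M, 1%:M; rewrite addn0 !mulmx1. Qed.

Lemma sum_ffun_recl (T : finType) k (f : {ffun 'I_k.+1 -> T} -> F) :
  \sum_X f X = \sum_x \sum_(Y : {ffun 'I_k -> T})
    f [ffun i => if unlift ord0 i is Some j then Y j else x].
Proof.
pose h (p : T * {ffun 'I_k -> T}) : {ffun 'I_k.+1 -> T} :=
  [ffun i => if unlift ord0 i is Some j then p.2 j else p.1].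
rewrite pair_bigA (reindex h) //=.
exists (fun X => (X ord0, [ffun j => X (lift ord0 j)])) => [[x Y] _|X _] /=.
  congr (_, _); first by rewrite ffunE unlift_none.
  by apply/ffunP => j; rewrite !ffunE liftK.
by apply/ffunP => i; rewrite ffunE; case: unliftP => [j ->|->]; rewrite ?ffunE.
Qed.

Lemma prodE_independent N k (p : 'I_k -> R -> F) (Psi : 'M[R]_N -> F) (A : 'M[R]_N) :
  \sum_(X : {ffun 'I_k -> 'M[R]_N})
     independent_law (fun i => @mxlaw F R (p i) N N) X * Psi (A *m \prod_(i < k) X i) =
  prodE [seq p i | i <- enum 'I_k] Psi A.
Proof.
elim: k p A => [|k IH] p A.
  rewrite enum_ord0 /= (eq_bigr (fun=> Psi A)) => [|X _].
    by rewrite sumr_const card_ffun card_ord expn0 mulr1n.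
  by rewrite /independent_law !big_ord0 mul1r mulmx1.
rewrite sum_ffun_recl enum_ordSl /= -map_comp /Emx; apply: eq_bigr => X _.
rewrite -[[seq _ | _ <- _]]/[seq (p \o lift ord0) i | i <- enum 'I_k].
rewrite -(IH (p \o lift ord0)) mulr_sumr; apply: eq_bigr => Y _.
rewrite /independent_law !big_ord_recl !ffunE unlift_none -mulrA.
congr (_ * (_ * Psi _)).
  by apply: eq_bigr => i _; rewrite ffunE liftK.
rewrite -mulmxA; congr (_ *m _); congr (_ *m _).
by apply: eq_bigr => i _; rewrite ffunE liftK.
Qed.

End ProductChain.

(** * Choice of the parameters *)

Section Rates.
Variables (F : realType) (R : finComUnitRingType).
Local Notation q := (#|R|%:R : F).

Lemma double_sub_ge m N : (2 * m <= N)%N -> (N <= 2 * (N - m))%N.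
Proof. by lia. Qed.

(** The slack [n = N %/ b] is linear in [N], so [(nu / q) ^ n] decays, but small enough that
    [q ^ (k * n)] does not destroy the decay of [e N + tau ^ N]. *)
Lemma step_error_geo (I : finType) (xi : I -> R -> F) (k : nat) :
  (forall i, generic_distribution (xi i)) ->
  exists (b : nat) (d E : nat -> F), [/\ geo E, forall N, 0 < d N,
    forall N, (k * (N %/ b) <= N)%N &
    forall N i j, (j < k)%N ->
      step_error (xi i) (N - j.+1 * (N %/ b)) (N %/ b) N (j.+1 * (N %/ b)) (d N) <= E N /\
      defect (xi i) (N - j.+1 * (N %/ b)) (N %/ b) N <= E N].
Proof.
move=> xiP; have [e [e_geo e_ge0 eP]] := conc_sum_bound_family xiP.
have q_gt0 : 0 < q := card_ring_gt0 F R.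
have q_ge1 : 1 <= q by rewrite ler1n -(ltr0n F).
pose tau := \big[Order.max/0]_i collision_mass (xi i).
have tau_ge0 : 0 <= tau by exact: bigmax_ge_id.
have tau_lt1 : tau < 1.
  by apply/bigmax_ltP; split=> // i _; case: (xiP i) => ? ? _; apply: collision_mass_lt1.
have tauX_geo : geo (fun N => tau ^+ N).
  have t01 : 0 <= tau < 1 by rewrite tau_ge0.
  by apply: geo_le (geo_divn t01 (isT : (0 < 1)%N)) => N; rewrite divn1.
have [K [r [K_ge0 /andP[r_gt0 r_lt1] KrP]]] := geoD e_geo tauX_geo.
(* Since [b >= N0], this gives [q ^ k * r ^ b <= 1 / 2], hence the decay of [h]. *)
have [N0 N0P] : exists N0, forall N, (N0 <= N)%N -> r ^+ N <= (2 * q ^+ k)^-1.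
  apply: geo_small; last by rewrite invr_gt0 mulr_gt0 ?exprn_gt0.
  have r01 : 0 <= r < 1 by rewrite ltW.
  by apply: geo_le (geo_divn r01 (isT : (0 < 1)%N)) => N; rewrite divn1.
(* [b > 2 * k] gives [2 * k * n <= N], so that [N <= 2 * L] at each of the [k] stages. *)
pose b := (2 * k + N0).+1; pose n N := (N %/ b)%N.
have bn N : (b * n N <= N)%N by rewrite mulnC leq_trunc_div.
have kn N : (2 * (k * n N) <= N)%N.
  by apply: leq_trans (bn N); rewrite mulnA leq_mul2r ltnW ?orbT // ltnS leq_addr.
pose h N := q ^+ (k * n N) * (e N + tau ^+ N).
have h_ge0 N : 0 <= h N.
  by rewrite mulr_ge0 ?exprn_ge0 ?(ltW q_gt0) // addr_ge0 ?exprn_ge0.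
have qXge1 m : 1 <= q ^+ m by rewrite exprn_ege1.
have h_geo : geo h.
  have half : 0 <= (2^-1 : F) < 1 by apply/andP; split; lra.
  apply: geo_le (geoZ K_ge0 (geo_divn half (isT : (0 < b)%N))) => N.
  rewrite -/(n N) /h; apply: (@le_trans _ _ (q ^+ (k * n N) * (K * r ^+ N))).
    by rewrite ler_wpM2l ?exprn_ge0 // ltW.
  rewrite mulrCA ler_wpM2l //.
  apply: (@le_trans _ _ ((q ^+ k * r ^+ b) ^+ n N)).
    rewrite exprMn -!exprM ler_wpM2l ?exprn_ge0 ?(ltW q_gt0) //.
    exact: (ler_wiXn2l (ltW r_gt0) (ltW r_lt1)).
  apply: lerXn2r; rewrite ?nnegrE ?invr_ge0 //.
    by rewrite mulr_ge0 ?exprn_ge0 // ltW.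
  have rb : r ^+ b <= (2 * q ^+ k)^-1 by apply: N0P; rewrite ltnW // ltnS leq_addl.
  apply: (le_trans (ler_wpM2l (exprn_ge0 k (ltW q_gt0)) rb)).
  by rewrite invfM mulrCA mulfV ?mulr1 // expf_neq0 // gt_eqF.
have [C C_ge0 hC] := geo_bounded h_geo.
pose mu := nonunit_number F R / q.
have mu_ge0 : 0 <= mu by rewrite divr_ge0 // ltW // nonunit_number_gt0.
have mu_lt1 : mu < 1 by rewrite ltr_pdivrMr // mul1r nonunit_number_lt.
pose g N := 2 * h N + (1 + 2 * C) * mu ^+ n N.
have g_geo : geo g.
  apply: geoD; first exact: geoZ.
  by apply: geoZ; [lra | apply: geo_divn => //; rewrite mu_ge0].
have [K' [r' [K'_ge0 /andP[r'_gt0 r'_lt1] gP]]] := g_geo.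
(* The chi-square excess is at most [K' * r' ^ N]; the choice [d = s ^ N] with [s ^ 2 = r'] balances
   [d] against this excess divided by [d]. *)
pose s := Num.sqrt r'; have s_gt0 : 0 < s by rewrite sqrtr_gt0.
have s2 : s ^+ 2 = r' by rewrite sqr_sqrtr // ltW.
have s_lt1 : s < 1 by rewrite -(@ltr_pXn2r _ 2) ?nnegrE ?(ltW s_gt0) // s2 expr1n.
have sX_geo : geo (fun N => s ^+ N).
  have s01 : 0 <= s < 1 by rewrite ltW.
  by apply: geo_le (geo_divn s01 (isT : (0 < 1)%N)) => N; rewrite divn1.
exists b, (fun N => s ^+ N), (fun N => g N + N%:R * ((1 + K') * s ^+ N)); split.
- by apply: geoD => //; apply: geo_natM; apply: geoZ => //; lra.
- by move=> N; rewrite exprn_gt0.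
- by move=> N; apply: leq_trans (kn N); rewrite leq_pmull.
move=> N i j jk; rewrite -/(n N); set n' := (j.+1 * n N)%N; set L := (N - n')%N.
have n'k : (n' <= k * n N)%N by rewrite leq_mul2r jk orbT.
have n'N2 : (2 * n' <= N)%N by apply: leq_trans (kn N); rewrite leq_mul2l.
have n'N : (n' <= N)%N by apply: leq_trans n'N2; rewrite leq_pmull.
have LN : (L <= N)%N by rewrite leq_subr.
have NL : (N <= 2 * L)%N := double_sub_ge n'N2.
set S := conc_sum (xi i) L N; have SP : S <= _ := eP i L N LN NL.
have S_ge0 : 0 <= S by apply: sumr_ge0 => w _; rewrite exprn_ge0 ?conc_ge0.
set x := q ^+ N / q ^+ L; have xE : x = q ^+ n'.
  by rewrite /x -(subnK n'N) -/L exprD mulrAC mulfV ?mul1r // expf_neq0 // gt_eqF.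
have x_ge0 : 0 <= x by rewrite xE exprn_ge0 // ltW.
have x_le : x <= q ^+ (k * n N) by rewrite xE ler_weXn2l.
have t_ge0 : 0 <= collision_mass (xi i) ^+ N.
  by case: (xiP i) => ? _ _; rewrite exprn_ge0 // collision_mass_ge0.
have t_le : collision_mass (xi i) ^+ N <= tau ^+ N.
  case: (xiP i) => ? _ _; rewrite lerXn2r ?nnegrE ?collision_mass_ge0 //.
  exact: (le_bigmax _ (fun i => collision_mass (xi i))).
have xet : x * (e N + collision_mass (xi i) ^+ N) <= h N.
  by rewrite /h ler_pM ?addr_ge0 // lerD2l.
have e_h : e N <= h N.
  rewrite -[leLHS]mul1r /h ler_pM //.
  by rewrite lerDl exprn_ge0.
have xS : x * S <= 1 + e N + x * e N.
  apply: le_trans (ler_wpM2l x_ge0 SP) _.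
  have x1 : x * (q ^+ L / q ^+ N) = 1.
    by rewrite /x; field; rewrite !expf_neq0 // gt_eqF.
  by rewrite mulrDr [X in X + _]mulrA x1 mul1r.
have xt_ge0 : 0 <= x * collision_mass (xi i) ^+ N by rewrite mulr_ge0.
have hN := hC N; have hge := h_ge0 N.
have defE : defect (xi i) L (n N) N = mu ^+ n N * (x * S) by rewrite /defect -/mu -/x -/S mulrA.
have xe : x * e N + x * collision_mass (xi i) ^+ N <= h N by rewrite -mulrDr.
have def_le : defect (xi i) L (n N) N <= (1 + 2 * C) * mu ^+ n N.
  rewrite defE mulrC ler_wpM2r ?exprn_ge0 //; apply: le_trans xS _; lra.
have def_ge0 : 0 <= defect (xi i) L (n N) N by rewrite defE !mulr_ge0 ?exprn_ge0.
have sN : 0 < s ^+ N by rewrite exprn_gt0.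
have main_ge0 : 0 <= N%:R * ((1 + K') * s ^+ N).
  by rewrite !mulr_ge0 ?(ltW sN) //; lra.
split; last by rewrite /g; lra.
rewrite /step_error -/x -/S; apply: lerD; first by rewrite /g; lra.
have Xg : x * (S + collision_mass (xi i) ^+ N) - (1 - defect (xi i) L (n N) N) <= K' * r' ^+ N.
  by apply: le_trans (gP N); rewrite /g mulrDr; lra.
have Xs : (x * (S + collision_mass (xi i) ^+ N) - (1 - defect (xi i) L (n N) N)) / s ^+ N <=
    K' * s ^+ N.
  by rewrite ler_pdivrMr // -[leRHS]mulrA -expr2 -exprM mulnC exprM s2.
apply: (@le_trans _ _ (n'%:R * ((1 + K') * s ^+ N))); last first.
  by rewrite ler_wpM2r ?ler_nat // mulr_ge0 ?(ltW sN) //; lra.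
rewrite ler_wpM2l //; have KsN : 0 <= K' * s ^+ N by rewrite mulr_ge0 // ltW.
lra.
Qed.

End Rates.

(** * From events on isomorphism classes to means of indicators *)

Section TotalVariation.
Variables (F : realType) (R : finComUnitRingType).
Local Notation uni := (@uniform_distribution F R).

Lemma mxlaw_uniform_distribution N :
  @uniform_distribution F 'M[R]_N = @mxlaw F R uni N N.
Proof.
apply/funext => A; rewrite mxlaw_uniform /uniform_distribution card_mx natrX.
by rewrite -exprM exprVn.
Qed.

Lemma prob_coker_prod N k (p : 'I_k -> R -> F) (E : (lmodType R -> Prop) -> Prop) :
  prob (independent_law (fun i => @mxlaw F R (p i) N N))
    [set X | E (@coker_prod R k N X)]%classic =
  prodE [seq p i | i <- enum 'I_k]
    (fun A : 'M[R]_N => `[< E (iso_class (coker A)) >]%:R) 1%:M.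
Proof.
rewrite -prodE_independent /prob big_mkcond /=; apply: eq_bigr => X _.
have -> : (X \in [set X | E (@coker_prod R k N X)]%classic) = `[< E (coker_prod X) >].
  by apply/idP/asboolP; rewrite in_setE.
by rewrite mul1mx /coker_prod; case: asboolP; rewrite ?mulr1 ?mulr0.
Qed.

End TotalVariation.

Theorem mainTheorem2 (F : realType) (R : finComUnitRingType)
    (R_local : local_ring R) (k : nat) (k_gt0 : (0 < k)%N)
    (xi : 'I_k -> R -> F)
    (xi_distr : forall i, is_distribution (xi i))
    (xi_unit : forall i, exists x y : R,
       [/\ x \in support_of (xi i), y \in support_of (xi i)
         & x - y \is a GRing.unit])
    (xi_affine : forall i (S : {set R}) (u b : R), proper_subring S ->
       ~ (support_of (xi i) \subset affine_translate u b S)) :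
  exists c K : F, [/\ 0 < c, 0 < K &
    forall N : nat, (0 < N)%N ->
      dTV (independent_law (fun i => @iid_matrix_law F R N (xi i)))
          (@coker_prod R k N)
          (independent_law (fun=> @uniform_distribution F 'M[R]_N))
          (@coker_prod R k N)
      <= K * expR (- (c * N%:R))].
Proof.
have nonunitD := local_ring_nonunitD R_local.
(* The uniform law joins the family as the index [None], so that one choice of parameters serves all
   the laws being compared. *)
pose xi' (o : option 'I_k) := if o is Some i then xi i else @uniform_distribution F R.
have xi'P o : generic_distribution (xi' o).
  case: o => [i|]; last exact: uniform_generic.
  by split; [exact: xi_distr | exact: xi_unit | exact: xi_affine].
have [b [d [E [E_geo d_gt0 kn stepP]]]] := step_error_geo k xi'P.
have [K [r [K_ge0 r01 KrP]]] : geo (fun N => k%:R * (3 * E N)).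
  by apply: geoZ; rewrite ?ler0n //; apply: geoZ.
have r_gt0 : 0 < r by case/andP: r01.
(* [exp (- c N) = r ^ N] for [c = - ln r]; 1 is added because [K] is only known to be
   nonnegative. *)
exists (- ln r), (K + 1); split; first by rewrite oppr_gt0 ln_lt0.
  by rewrite ltr_wpDl.
move=> N _; rewrite mulNr opprK (mulrC (ln r)) expRM_natl lnK //.
(* The supremum is bounded event by event; the full event shows that the set of values is
   nonempty. *)
apply: ge_sup; first by eexists; exists (fun=> True).
move=> _ [Ev ->]; rewrite mxlaw_uniform_distribution.
have -> : prob (independent_law (fun i => @iid_matrix_law F R N (xi i)))
    [set w | Ev (coker_prod w)]%classic = _ := prob_coker_prod N xi Ev.
rewrite (prob_coker_prod N (fun=> @uniform_distribution F R) Ev).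
set Psi := fun A : 'M[R]_N => _.
have -> : [seq @uniform_distribution F R | _ <- enum 'I_k] =
    nseq (size [seq xi i | i <- enum 'I_k]) (@uniform_distribution F R).
  by rewrite size_map; elim: (enum _) => //= i s ->.
have Psi_inv : equivalence_invariant Psi.
  by move=> A U V UU VU; rewrite /Psi iso_class_coker.
have Psi01 B : 0 <= Psi B <= 1 by rewrite /Psi ler0n lern1 leq_b1.
have size_xi : size [seq xi i | i <- enum 'I_k] = k by rewrite size_map size_enum_ord.
apply: (@le_trans _ _ (k%:R * (3 * E N))).
  rewrite -[in k%:R]size_xi.
  apply: (prodE_chain nonunitD (n := N %/ b) (k := k) (j := 0) (d_gt0 N)) => //.
  - by rewrite size_xi addn0.
  - by move=> p /mapP[i _ ->]; case: (xi'P (Some i)).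
  - move=> p j; rewrite inE => /orP[/eqP->|/mapP[i _ ->]] jk.
      exact: (stepP N None j jk).
    exact: (stepP N (Some i) j jk).
  - by rewrite mul0n; apply: corank_le0.
apply: le_trans (KrP N) _; rewrite ler_wpM2r ?exprn_ge0 ?(ltW r_gt0) //.
by rewrite lerDl.
Qed.
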